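(* Let $t>0$, $\delta\in[0,\infty)$, and let $K\subset\mathbb{R}^d$ be a convex body. Then the expectation of the proximity functional $\pi_t(K,\delta)$ of the Poisson $k$-flat process $\eta_t$ is $$\mathbb{E}\,\pi_t(K,\delta)=\frac{t^2}{2}\,\kappa_{d-2k}\,\delta^{d-2k}\,V_d(K)\int_{\mathbb{G}^d_k}\int_{\mathbb{G}^d_k}[M,L]\,\mathbb{Q}(\mathrm{d}L)\,\mathbb{Q}(\mathrm{d}M).$$
   Context: Let $d,k$ be integers with $1\le k<d/2$. $\mathbb{G}_k^d$ is the Grassmannian of $k$-dimensional linear subspaces of $\mathbb{R}^d$ and $\mathbb{A}_k^d$ the space of $k$-dimensional affine subspaces ($k$-flats) of $\mathbb{R}^d$. $\mathbb{Q}$ is a probability measure on $\mathbb{G}_k^d$ such that two independent random subspaces with distribution $\mathbb{Q}$ are in general position (i.e. intersect only in $\{0\}$) with probability one. For a linear subspace $W$, $\ell_W$ denotes Lebesgue measure on $W$. For $t>0$, $\eta_t$ is a Poisson point process on $\mathbb{A}_k^d$ with intensity measure $\Theta_t$ given, for non-negative measurable $f:\mathbb{A}_k^d\to\mathbb{R}$, by $$\int_{\mathbb{A}_k^d}f(E)\,\Theta_t(\mathrm{d}E)=t\int_{\mathbb{G}_k^d}\int_{L^\perp}f(L+x)\,\ell_{L^\perp}(\mathrm{d}x)\,\mathbb{Q}(\mathrm{d}L).$$ $\eta_{t,\neq}^2$ is the collection of ordered pairs $(E,F)$ of distinct flats of $\eta_t$. The flats of $\eta_t$ are almost surely pairwise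 in general position (their direction spaces intersect only in $\{0\}$). For $E,F\in\mathbb{A}_k^d$, $\mathrm{dist}(E,F)=\inf\{\|x-y\|:x\in E,\,y\in F\}$. If $E,F$ are in general position, this distance is attained at uniquely determined points $x_E\in E$, $y_F\in F$, and $m(E,F)=(x_E+y_F)/2$ is the midpoint of $E$ and $F$. A convex body is a compact convex set $K\subset\mathbb{R}^d$ with $V_d(K)>0$, where $V_d$ is $d$-dimensional volume. The proximity functional is $$\pi_t(K,\delta)=\frac12\sum_{(E,F)\in\eta_{t,\neq}^2}\mathbf{1}\{\mathrm{dist}(E,F)\le\delta,\ m(E,F)\in K\}.$$ $[M,L]$ denotes the subspace determinant of $M,L\in\mathbb{G}_k^d$, i.e. the $2k$-dimensional volume of the parallelepiped spanned by the union of an orthonormal basis of $M$ and an orthonormal basis of $L$. $\kappa_n$ is the volume of the unit ball in $\mathbb{R}^n$. *)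

(* Defs.v *)
From HB Require Import structures.
From mathcomp Require Import all_boot all_order all_algebra.
From mathcomp Require Import all_classical all_reals all_analysis.
From mathcomp Require Import measurable_realfun.
Import Order.TTheory GRing.Theory Num.Theory.
Import numFieldNormedType.Exports.

Set Implicit Arguments.
Unset Strict Implicit.
Unset Printing Implicit Defensive.

Local Open Scope classical_set_scope.
Local Open Scope ring_scope.

(* Matrices carry the sigma-algebra generated by their entries, which for real
   entries is the Borel sigma-algebra. *)
Definition matrix_display : measure_display -> measure_display.
Proof. exact. Qed.

Section measurable_matrix.
Context {d : measure_display} {T : measurableType d} (m n : nat).

Definition entry_preimages : set (set 'M[T]_(m, n)) :=
  \bigcup_(ij : 'I_m * 'I_n)
    preimage_set_system setT (fun M : 'M[T]_(m, n) => M ij.1 ij.2) measurable.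

Let mx_set0 : <<s entry_preimages >> set0.
Proof. exact: sigma_algebra0. Qed.

Let mx_setC A : <<s entry_preimages >> A -> <<s entry_preimages >> (~` A).
Proof. exact: sigma_algebraC. Qed.

Let mx_bigcup (F : (set 'M[T]_(m, n))^nat) :
  (forall i, <<s entry_preimages >> (F i)) ->
  <<s entry_preimages >> (\bigcup_i F i).
Proof. exact: sigma_algebra_bigcup. Qed.

HB.instance Definition _ := @isMeasurable.Build (matrix_display d)
  'M[T]_(m, n) <<s entry_preimages >> mx_set0 mx_setC mx_bigcup.

End measurable_matrix.

Lemma measurable_entry d (T : measurableType d) m n i j :
  measurable_fun setT (fun M : 'M[T]_(m, n) => M i j).
Proof.
move=> _ Y mY; apply: sub_sigma_algebra => /=.
by exists (i, j) => //; exists Y.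
Qed.

Lemma measurable_fun_mxP d1 d2 (T1 : measurableType d1) (T2 : measurableType d2)
    m n (f : T1 -> 'M[T2]_(m, n)) :
  (forall i j, measurable_fun setT (fun x => f x i j)) -> measurable_fun setT f.
Proof.
move=> mf; apply: (@measurability _ _ _ _ _ _ (@entry_preimages _ T2 m n)) => //.
move=> A [B [[i j] _ [C mC <-]]] <-.
by rewrite setTI; exact: mf.
Qed.

(* Lebesgue measure on R^n, by recursion on n: the image of the product of
   Lebesgue measure on R and Lebesgue measure on R^n under (x, v) |-> x :: v *)
Section lebesgue_rV.
Variable R : realType.

Definition rV_cons n (p : R * 'rV[R]_n) : 'rV[R]_n.+1 :=
  row_mx (const_mx p.1 : 'rV_1) p.2.

Lemma measurable_rV_cons n : measurable_fun setT (@rV_cons n).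
Proof.
apply: measurable_fun_mxP => i j.
under eq_fun do rewrite /rV_cons mxE.
case: fintype.split => j'.
  by under eq_fun do rewrite mxE; exact: measurable_fst.
exact: (measurableT_comp (measurable_entry _ _)).
Qed.

Section step.
Variables (n : nat) (mu : {sigma_finite_measure set 'rV[R]_n -> \bar R}).

Definition lebesgue_rV_step : set 'rV[R]_n.+1 -> \bar R :=
  pushforward (@lebesgue_measure R \x mu)%E (@rV_cons n).

Let step0 : lebesgue_rV_step set0 = 0%E.
Proof. by rewrite /lebesgue_rV_step /pushforward preimage_set0 measure0. Qed.

Let step_ge0 A : (0 <= lebesgue_rV_step A)%E.
Proof. by rewrite /lebesgue_rV_step /pushforward; exact: measure_ge0. Qed.

Let step_sigma_additive : semi_sigma_additive lebesgue_rV_step.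
Proof.
move=> F mF tF mUF; rewrite /lebesgue_rV_step /pushforward preimage_bigcup.
apply: measure_semi_sigma_additive.
- by move=> i; rewrite -[X in measurable X]setTI; exact: measurable_rV_cons.
- apply/trivIsetP => /= i j _ _ ij; rewrite -preimage_setI.
  by move/trivIsetP : tF => /(_ _ _ _ _ ij) ->//; rewrite preimage_set0.
- by rewrite -preimage_bigcup -[X in measurable X]setTI; exact: measurable_rV_cons.
Qed.

HB.instance Definition _ := isMeasure.Build _ _ _
  lebesgue_rV_step step0 step_ge0 step_sigma_additive.

Definition rV_uncons (v : 'rV[R]_n.+1) : R * 'rV[R]_n :=
  (v ord0 ord0, rsubmx (v : 'rV_(1 + n))).

Lemma measurable_rV_uncons : measurable_fun setT rV_uncons.
Proof.
apply/measurable_fun_pair; first exact: measurable_entry.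
apply: measurable_fun_mxP => i j; rewrite /rsubmx.
under eq_fun do rewrite mxE.
exact: measurable_entry.
Qed.

Lemma rV_consK : cancel (@rV_cons n) rV_uncons.
Proof.
move=> [x v]; congr pair => /=; last by rewrite row_mxKr.
rewrite /rV_cons mxE; case: fintype.splitP => j; last by case: j.
by rewrite mxE.
Qed.

Let step_sigma_finite : sigma_finite setT lebesgue_rV_step.
Proof.
have /sigma_finiteP[F [TF ndF Foo]] := sigma_finiteT (@lebesgue_measure R).
have /sigma_finiteP[G [TG ndG Goo]] := sigma_finiteT mu.
exists (fun i => rV_uncons @^-1` (F i `*` G i)).
  rewrite -preimage_bigcup -(preimage_setT rV_uncons); congr (_ @^-1` _).
  rewrite -setXTT TF TG predeqE => -[x y]; split.
    move=> [/= [i _ Fix] [j _ Gjy]]; exists (maxn i j) => //; split.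
    - by move: x Fix; exact/subsetPset/ndF/leq_maxl.
    - by move: y Gjy; exact/subsetPset/ndG/leq_maxr.
  by move=> [i _ []/= ? ?]; split; exists i.
move=> i; have [mFi Fioo] := Foo i; have [mGi Gioo] := Goo i; split.
  rewrite -[X in measurable X]setTI; apply: measurable_rV_uncons => //.
  exact: measurableX.
rewrite /lebesgue_rV_step /pushforward -comp_preimage.
rewrite (_ : _ \o _ = id); last by apply/funext => x /=; rewrite rV_consK.
rewrite preimage_id [ltLHS](product_measure1E lebesgue_measure)//.
by rewrite lte_mul_pinfty// ge0_fin_numE.
Qed.

HB.instance Definition _ := @Measure_isSigmaFinite.Build _ _ _
  lebesgue_rV_step step_sigma_finite.

End step.

Fixpoint lebesgue_rV n : {sigma_finite_measure set 'rV[R]_n -> \bar R} :=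
  match n with
  | 0 => dirac (0 : 'rV[R]_0)
  | n'.+1 => lebesgue_rV_step (lebesgue_rV n')
  end.

End lebesgue_rV.

Section euclidean.
Context {R : realType}.

Definition dotprod n (x y : 'rV[R]_n) : R := (x *m y^T) 0 0.

(* The norm of the library on 'rV[R]_n is the supremum norm; the Euclidean one
   induces the same topology. *)
Definition enorm n (x : 'rV[R]_n) : R := Num.sqrt (dotprod x x).

Definition unit_ball_volume n : \bar R :=
  lebesgue_rV R n [set x | enorm x <= 1].

Definition convex_body n (K : set 'rV[R]_n) : Prop :=
  [/\ compact K, convex_set (K : set (convex_lmodType 'rV[R]_n))
    & (0 < lebesgue_rV R n K)%E].

Definition orthocomp n (W : {vspace 'rV[R]_n}) : {vspace 'rV[R]_n} :=
  (\bigcap_(i < \dim W)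
     lker (linfun (dotprod (vbasis W)`_i : 'rV[R]_n -> R^o)))%VS.

Definition is_onb n (W : {vspace 'rV[R]_n}) (B : 'M[R]_(\dim W, n)) : Prop :=
  B *m B^T = 1%:M /\ forall i, row i B \in W.

Definition onb n (W : {vspace 'rV[R]_n}) : 'M[R]_(\dim W, n) :=
  xget 0 [set B | is_onb B].

Lemma dotprod_linear n (x : 'rV[R]_n) :
  linear (dotprod x : 'rV[R]_n -> R^o).
Proof.
by move=> a u v; rewrite /dotprod linearP/= mulmxDr -scalemxAr !mxE.
Qed.

HB.instance Definition _ n (x : 'rV[R]_n) :=
  GRing.isLinear.Build R 'rV[R]_n R^o _ (dotprod x : 'rV[R]_n -> R^o)
    (@dotprod_linear n x).

Lemma dotprodC n (x y : 'rV[R]_n) : dotprod x y = dotprod y x.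
Proof. by rewrite /dotprod -[in LHS](trmxK x) -trmx_mul mxE. Qed.

Lemma dotprodE n (x y : 'rV[R]_n) : dotprod x y = \sum_i x 0 i * y 0 i.
Proof. by rewrite /dotprod mxE; apply: eq_bigr => i _; rewrite mxE. Qed.

Lemma dotprod_gt0 n (x : 'rV[R]_n) : x != 0 -> 0 < dotprod x x.
Proof.
move=> x0; rewrite dotprodE lt_def sumr_ge0 ?andbT; last first.
  by move=> i _; rewrite -expr2 sqr_ge0.
apply: contra x0; rewrite psumr_eq0; last first.
  by move=> i _; rewrite -expr2 sqr_ge0.
move=> /allP xi; apply/eqP/rowP => i; rewrite mxE.
have := xi i; rewrite mem_index_enum => /(_ isT) /=.
by rewrite -expr2 sqrf_eq0 => /eqP.
Qed.

Lemma mem_orthocomp n (W : {vspace 'rV[R]_n}) (x : 'rV[R]_n) :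
  x \in orthocomp W <-> forall w, w \in W -> dotprod w x = 0.
Proof.
rewrite /orthocomp memvE; split=> [/subv_bigcapP xW w wW|xW].
  rewrite dotprodC (coord_vbasis wW) linear_sum/= big1// => i _.
  rewrite linearZ/= dotprodC.
  have := xW i isT; rewrite -memvE memv_ker lfunE/= => /eqP ->.
  by rewrite scaler0.
apply/subv_bigcapP => i _; rewrite -memvE memv_ker lfunE/=; apply/eqP/xW.
by apply: vbasis_mem; rewrite mem_nth// size_tuple.
Qed.

Lemma onb_ex n (W : {vspace 'rV[R]_n}) : exists B, is_onb (W := W) B.
Proof.
rewrite /is_onb; move: {2}(\dim W) (erefl (\dim W)) => m; move: W.
suff H : forall W : {vspace 'rV[R]_n}, \dim W = m ->
    exists B : 'M[R]_(m, n), B *m B^T = 1%:M /\ forall i, row i B \in W.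
  by move=> W Wm; have := H W Wm; rewrite -Wm.
elim: m => [|m IH] W Wm.
  exists 0; split; first by apply/matrixP => -[].
  by case.
have W0 : W != 0%VS by rewrite -dimv_eq0 Wm.
have v0 : vpick W != 0 by rewrite vpick0.
pose c := (enorm (vpick W))^-1; pose u := c *: vpick W.
have en0 : 0 < enorm (vpick W) by rewrite sqrtr_gt0 dotprod_gt0.
have uu : dotprod u u = 1.
  rewrite /u linearZ/= dotprodC linearZ/= /c.
  rewrite -[dotprod _ _]sqr_sqrtr ?ltW ?dotprod_gt0// -/(enorm _).
  by rewrite /GRing.scale/= expr2 mulKf ?gt_eqF// mulVf ?gt_eqF.
have uW : u \in W by rewrite memvZ// memv_pick.
pose f := linfun (dotprod u : _ -> R^o).
have fW : \dim (f @: W) = 1%N.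
  apply/eqP; rewrite eqn_leq; apply/andP; split.
    by rewrite (leq_trans (dimvS (subvf _)))// dimvf /dim/=.
  rewrite lt0n dimv_eq0; apply/eqP => fW0.
  have : f u \in (f @: W)%VS by rewrite memv_img.
  by rewrite fW0 memv0 lfunE/= uu oner_eq0.
have [|B [BB BW]] := IH (W :&: lker f)%VS.
  by have := limg_ker_dim f W; rewrite fW Wm addn1 => -[].
have Bu i : dotprod u (row i B) = 0.
  by have := BW i; rewrite memv_cap memv_ker lfunE/= => /andP[_ /eqP].
suff : exists C : 'M[R]_(1 + m, n), C *m C^T = 1%:M /\ forall i, row i C \in W.
  by [].
exists (col_mx u B); split.
  rewrite tr_col_mx mul_col_row BB [RHS]scalar_mx_block.
  have uB : u *m B^T = 0.
    apply/rowP => i; rewrite [RHS]mxE -[RHS](Bu i) /dotprod !mxE.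
    by apply: eq_bigr => j _; rewrite !mxE.
  congr block_mx => //.
    by apply/matrixP => i j; rewrite !ord1 -/(dotprod u u) uu !mxE.
  by rewrite -(trmxK (B *m u^T)) trmx_mul trmxK uB trmx0.
move=> i; rewrite (_ : row i _ = if fintype.split (i : 'I_(1 + m)) is inr j then row j B else u).
  by case: fintype.split => // j; have := BW j; rewrite memv_cap => /andP[].
apply/rowP => j; rewrite !mxE; case: fintype.split => k; rewrite ?ord1// mxE//.
Qed.

Lemma onbP n (W : {vspace 'rV[R]_n}) : is_onb (onb W).
Proof. exact: (xgetPex 0 (onb_ex W)). Qed.

End euclidean.

Section lebesgue_on.
Context {R : realType} {n : nat}.
Implicit Types W M L : {vspace 'rV[R]_n}.

Lemma measurable_mulmxr m (B : 'M[R]_(m, n)) :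
  measurable_fun setT (fun y : 'rV[R]_m => y *m B).
Proof.
apply: measurable_fun_mxP => i j; under eq_fun do rewrite mxE.
apply: measurable_sum => k; apply: measurable_funM => //.
exact: measurable_entry.
Qed.

(* Lebesgue measure on the subspace W, as a measure on the ambient space: the
   image of Lebesgue measure on R^(dim W) under the isometry onto W given by
   an orthonormal basis; it does not depend on that basis. *)
Definition lebesgue_on W : set 'rV[R]_n -> \bar R :=
  pushforward (lebesgue_rV R (\dim W)) (fun y => y *m onb W).

Section measure.
Variable W : {vspace 'rV[R]_n}.

Let lebesgue_on0 : lebesgue_on W set0 = 0%E.
Proof. by rewrite /lebesgue_on /pushforward preimage_set0 measure0. Qed.

Let lebesgue_on_ge0 A : (0 <= lebesgue_on W A)%E.
Proof. by rewrite /lebesgue_on /pushforward; exact: measure_ge0. Qed.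

Let lebesgue_on_sigma_additive : semi_sigma_additive (lebesgue_on W).
Proof.
move=> F mF tF mUF; rewrite /lebesgue_on /pushforward preimage_bigcup.
apply: measure_semi_sigma_additive.
- by move=> i; rewrite -[X in measurable X]setTI; exact: measurable_mulmxr.
- apply/trivIsetP => /= i j _ _ ij; rewrite -preimage_setI.
  by move/trivIsetP : tF => /(_ _ _ _ _ ij) ->//; rewrite preimage_set0.
- by rewrite -preimage_bigcup -[X in measurable X]setTI; exact: measurable_mulmxr.
Qed.

HB.instance Definition _ := isMeasure.Build _ _ _
  (lebesgue_on W) lebesgue_on0 lebesgue_on_ge0 lebesgue_on_sigma_additive.

End measure.

Definition parallelepiped m (A : 'M[R]_(m, n)) : set 'rV[R]_n :=
  [set y *m A | y in [set y : 'rV[R]_m | forall i, 0 <= y 0 i <= 1]].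

Definition general_position M L : Prop := (M :&: L = 0)%VS.

(* The (dim M + dim L)-dimensional volume of the parallelepiped vanishes when
   the parallelepiped lies in a subspace of smaller dimension, that is when
   M and L are not in general position. *)
Definition subspace_det M L : \bar R :=
  if (\dim (M + L) == \dim M + \dim L)%N then
    lebesgue_on (M + L) (parallelepiped (col_mx (onb M) (onb L)))
  else 0%E.

End lebesgue_on.

(* The sigma-algebras on the spaces of linear and of affine subspaces are
   generated by the sets of subspaces hitting a given compact set, that is, they
   are induced by the Fell topology on closed sets, whose traces are the usual
   topologies of these spaces. *)
Definition hit_display : measure_display.
Proof. by constructor. Qed.

Section flats.
Context {R : realType} {d k : nat}.

Lemma exists_subspace : (2 * k < d)%N ->
  exists W : {vspace 'rV[R]_d}, \dim W == k.
Proof.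
move=> kd; have kd' : (k <= d)%N.
  by rewrite (leq_trans _ (ltnW kd))// mul2n -addnn leq_addr.
exists <<take k (vbasis {: 'rV[R]_d})>>%VS; apply/eqP.
have := basis_free (vbasisP {: 'rV[R]_d}).
rewrite -{1}(cat_take_drop k (vbasis _)) => /catl_free/eqP ->.
by rewrite size_takel// size_tuple dimvf /dim/= mul1n.
Qed.

Record grassmannian (kd : (2 * k < d)%N) := Grassmannian {
  linear_subspace :> {vspace 'rV[R]_d};
  _ : \dim linear_subspace == k
}.

Record flat (kd : (2 * k < d)%N) := Flat {
  flat_points :> set 'rV[R]_d;
  _ : exists (L : grassmannian kd) (x : 'rV[R]_d),
        flat_points = [set v + x | v in [set v | v \in linear_subspace L]]
}.

Variable kd : (2 * k < d)%N.

HB.instance Definition _ := [isSub for @linear_subspace kd].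
HB.instance Definition _ := [Choice of grassmannian kd by <:].

Definition some_subspace : grassmannian kd :=
  Grassmannian kd (svalP (cid (exists_subspace kd))).

HB.instance Definition _ := isPointed.Build (grassmannian kd) some_subspace.

HB.instance Definition _ := gen_eqMixin (flat kd).
HB.instance Definition _ := gen_choiceMixin (flat kd).

Definition translate (L : grassmannian kd) (x : 'rV[R]_d) : flat kd :=
  @Flat kd [set v + x | v in [set v | v \in linear_subspace L]]
    (ex_intro _ L (ex_intro _ x erefl)).

HB.instance Definition _ := isPointed.Build (flat kd) (translate some_subspace 0).

Definition grassmannian_hits : set (set (grassmannian kd)) :=
  [set [set L | exists2 x, C x & x \in linear_subspace L]
     | C in [set C : set 'rV[R]_d | compact C]].

Definition flat_hits : set (set (flat kd)) :=
  [set [set E | C `&` flat_points E !=set0]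
     | C in [set C : set 'rV[R]_d | compact C]].

HB.instance Definition _ := @isMeasurable.Build hit_display (grassmannian kd)
  <<s grassmannian_hits >> (@sigma_algebra0 _ setT grassmannian_hits)
  (@sigma_algebraC _ grassmannian_hits)
  (@sigma_algebra_bigcup _ setT grassmannian_hits).

HB.instance Definition _ := @isMeasurable.Build hit_display (flat kd)
  <<s flat_hits >> (@sigma_algebra0 _ setT flat_hits)
  (@sigma_algebraC _ flat_hits) (@sigma_algebra_bigcup _ setT flat_hits).

Definition flat_dist (E F : flat kd) : R :=
  inf [set enorm (x - y) | x in (E : set 'rV[R]_d) & y in (F : set 'rV[R]_d)].

(* a pair of points realizing the distance, which is unique when E and F are in
   general position *)
Definition closest_points (E F : flat kd) : 'rV[R]_d * 'rV[R]_d :=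
  xget (0, 0) [set p : 'rV[R]_d * 'rV[R]_d |
    [/\ flat_points E p.1, flat_points F p.2 & enorm (p.1 - p.2) = flat_dist E F]].

Definition midpoint (E F : flat kd) : 'rV[R]_d :=
  2^-1 *: ((closest_points E F).1 + (closest_points E F).2).

Definition distinct_pairs (eta : set (flat kd)) : set (flat kd * flat kd) :=
  [set p | [/\ eta p.1, eta p.2 & p.1 <> p.2]].

Definition proximity (eta : set (flat kd)) (K : set 'rV[R]_d) (delta : R) :
    \bar R :=
  ((2^-1)%:E * \esum_(p in distinct_pairs eta)
    (\1_[set q | flat_dist q.1 q.2 <= delta /\ K (midpoint q.1 q.2)] p)%:E)%E.

Definition is_flat_intensity (t : R) (Q : probability (grassmannian kd) R)
    (theta : {measure set (flat kd) -> \bar R}) : Prop :=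
  forall f : flat kd -> R, measurable_fun setT f -> (forall E, 0 <= f E) ->
  (\int[theta]_E (f E)%:E =
   t%:E * \int[Q]_L \int[lebesgue_on (orthocomp L)]_x (f (translate L x))%:E)%E.

End flats.
Arguments grassmannian R {d k} kd.
Arguments flat R {d k} kd.

Section poisson.
Context {R : realType} {d d' : measure_display} {Omega : measurableType d}
  {T : measurableType d'}.
Variable P : probability Omega R.

Definition mutually_independent n (X : 'I_n -> Omega -> \bar R) : Prop :=
  forall B : 'I_n -> set (\bar R), (forall i, measurable (B i)) ->
  P (\bigcap_i (X i @^-1` B i)) = (\prod_(i < n) P (X i @^-1` B i))%E.

(* The point process is encoded as the random set of its points; Poisson
   processes with diffuse intensity, as here, have no multiple points. The
   second argument of poisson_prob is a dummy. *)
Record poisson_process (theta : {measure set T -> \bar R})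
    (eta : Omega -> set T) : Prop := PoissonProcess {
  poisson_countable : forall w, countable (eta w);
  poisson_measurable : forall A, measurable A ->
    measurable_fun setT (fun w => counting (eta w `&` A) : \bar R);
  poisson_finite : forall A n, measurable A -> (theta A < +oo)%E ->
    P [set w | counting (eta w `&` A) = n%:R%:E :> \bar R] =
    poisson_prob (fine (theta A)) n [set n];
  poisson_infinite : forall A, measurable A -> theta A = +oo%E ->
    P [set w | counting (eta w `&` A) = +oo%E :> \bar R] = 1%E;
  poisson_independent : forall n (A : 'I_n -> set T),
    (forall i, measurable (A i)) -> trivIset setT A ->
    mutually_independent (fun i w => counting (eta w `&` A i))
}.

End poisson.

(* Main.v *)
Require Import Defs.
From HB Require Import structures.
From mathcomp Require Import all_boot all_order all_algebra.
From mathcomp Require Import all_classical all_reals all_analysis.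
From mathcomp Require Import measurable_realfun.
From mathcomp Require Import finmap zify ring lra.
Import Order.TTheory GRing.Theory Num.Theory.
Import numFieldNormedType.Exports.

(** A pair of flats E = M + x and F = L + y whose directions M and L meet only
    in 0 has a midpoint m and a difference vector w of its closest points; w is
    orthogonal to M + L, and (m, w) determines (E, F).  So a pair of flats with
    fixed directions can be parametrized in two ways: by the positions (x, y)
    in M^perp * L^perp, which is how the intensity measure sees it, or by
    (m, w) in R^d * (M + L)^perp, in which the condition that dist(E, F) is at
    most delta and that m lies in K becomes a product set.  The change from one
    parametrization to the other is linear and its Jacobian turns out to be the
    subspace determinant [M, L] (kin_mx_det); hence the pairs of flats with
    directions M and L that are counted have measure
    kappa_(d-2k) delta^(d-2k) V_d(K) [M, L] (kinematic).

    The Jacobian is computed through the matrix gap M L, the sum of the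
    orthogonal projections onto M^perp and L^perp.  It is invertible exactly in
    general position (gap_unit), it gives the midpoint as the solution of
    a linear equation (pair_mid), the Gram matrix of the change of
    parametrization is block diagonal with blocks gap M L and 1/2
    (kin_mx_gram), and by Sylvester's identity its determinant is, up to
    a power of 2, the square of [M, L] (subspace_detE).  The change of
    variables for Lebesgue measure itself is obtained from Gaussian elimination
    (dilates_det).

    It remains to pass from the Poisson process to its intensity theta: the
    mean number of pairs of distinct points in a set C of pairs is
    (theta * theta)(C) (campbell_pairs).  For C contained in a product of two
    disjoint sets of finite intensity this follows, by a Dynkin argument, from
    the independence of the counts; countably many such products cover all
    pairs of distinct flats, because flats are separated by countably many
    measurable sets.  For this and for the measurability of the set of counted
    pairs, a flat is described by two matrices, the projection orthogonal to its
    direction and its point closest to the origin; their entries are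
    obtained by polarization from squared distances, whose sublevel sets are
    the sets of flats hitting a ball.

    Pairs that are not in general position form a null set, so that almost
    surely no such pair occurs (intensity_degenerate_pairs); there the
    midpoint is an arbitrary choice and the proximity functional agrees with
    a measurable function only almost surely (integral_eq_off_null). *)

Set Implicit Arguments.
Unset Strict Implicit.
Unset Printing Implicit Defensive.

Local Open Scope classical_set_scope.
Local Open Scope ring_scope.

(** * Lebesgue measure under affine maps of the line and translations of space *)

Section line.
Variable R : realType.
Local Notation mu := (@lebesgue_measure R).
Local Open Scope ereal_scope.

Lemma measurable_affine (a b : R) :
  measurable_fun setT ((fun x => x * a + b)%R : measurableTypeR R -> measurableTypeR R).
Proof.
apply: measurable_funD => //; apply: measurable_funM => //.
Qed.

(** It suffices to compare half-open intervals, where both sides are lengths; a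
    negative slope reverses the interval and swaps its end points. *)
Lemma lebesgue_measure_affine (a b : R) (A : set R) : a != 0%R -> measurable A ->
  mu A = `|a|%:E * mu [set x | A (x * a + b)%R].
Proof.
move=> a0 mA.
have aa0 : (0 <= `|a|)%R by [].
apply: (@lebesgue_measure_unique _ (mscale (NngNum aa0) (pushforward mu
  ((fun x => x * a + b)%R : measurableTypeR R -> measurableTypeR R))) _ _ mA).
  exact: measurable_affine.
move=> mf X [[l u] /= _ <-].
rewrite /mscale/= /pushforward.
have [lu|ul] := ltP l u; last first.
  rewrite set_itv_ge ?bnd_simp ?preimage_set0 ?measure0 ?mule0//.
  by rewrite -leNgt.
have [ag|al] := ltP 0%R a.
  rewrite (_ : _ @^-1` _ = `](l - b) / a, (u - b) / a]%classic)%R; last first.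
    apply/seteqP; split => x /=; rewrite !in_itv/=;
      by rewrite ltr_pdivrMr// ler_pdivlMr// ltrBlDr lerBrDr.
  rewrite !lebesgue_measure_itv/= !lte_fin lu ltr_pM2r ?invr_gt0// ltrD2r lu.
  rewrite -!EFinB -EFinM gtr0_norm//; congr EFin.
  by field.
have {}al : (a < 0)%R by rewrite lt_neqAle a0.
rewrite (_ : _ @^-1` _ = `[(u - b) / a, (l - b) / a[%classic)%R; last first.
  apply/seteqP; split => x /=; rewrite !in_itv/=;
    by rewrite ltr_ndivlMr// ler_ndivrMr// ltrBlDr lerBrDr andbC.
rewrite !lebesgue_measure_itv/= !lte_fin lu ltr_nM2r ?invr_lt0// ltrD2r lu.
rewrite -!EFinB -EFinM ltr0_norm//; congr EFin.
by field.
Qed.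

End line.

Section line_integral.
Variable R : realType.
Local Notation mu := (@lebesgue_measure R).
Local Open Scope ereal_scope.

Lemma integral_affine (a b : R) (f : R -> \bar R) : a != 0%R ->
  measurable_fun setT f -> (forall x, 0 <= f x) ->
  \int[mu]_x f x = `|a|%:E * \int[mu]_x f (x * a + b)%R.
Proof.
move=> a0 mf f0; have aa0 : (0 <= `|a|)%R by [].
pose phi : measurableTypeR R -> measurableTypeR R := (fun x => x * a + b)%R.
have mphi : measurable_fun setT phi by exact: measurable_affine.
pose nu : {measure set (measurableTypeR R) -> \bar R} :=
  measure_function_pushforward__canonical__measure_function_Measure mu mphi.
transitivity (\int[mscale (NngNum aa0) nu]_x f x).
  by apply: eq_measure_integral => //= A mA _; exact: lebesgue_measure_affine.
rewrite ge0_integral_mscale//=; congr (_ * _).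
by rewrite ge0_integral_pushforward.
Qed.

End line_integral.

Section space.
Variable R : realType.
Local Notation mu := (@lebesgue_measure R).
Local Notation leb n := (lebesgue_rV R n).
Local Open Scope ereal_scope.

Lemma integral_rVS n (f : 'rV[R]_n.+1 -> \bar R) :
  measurable_fun setT f -> (forall x, 0 <= f x) ->
  \int[leb n.+1]_v f v = \int[mu]_x \int[leb n]_v f (rV_cons (x, v)).
Proof.
move=> mf f0.
rewrite [LHS](@ge0_integral_pushforward _ _ (measurableTypeR R * 'rV[R]_n)%type
  _ _ (@rV_cons R n) (@measurable_rV_cons R n) (mu \x leb n) setT)//.
rewrite preimage_setT.
apply: (@fubini_tonelli1 _ _ (measurableTypeR R) 'rV[R]_n R mu (leb n)
  (f \o @rV_cons R n)) => //.
  exact: measurableT_comp (@measurable_rV_cons R n).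
by move=> x; exact: f0.
Qed.

Lemma rV_cons_entry n (p : R * 'rV[R]_n) (i : 'I_1 + 'I_n) :
  rV_cons p 0%R (unsplit i : 'I_(1 + n)) =
  match i with inl _ => p.1 | inr j => p.2 0%R j end.
Proof.
by rewrite /rV_cons mxE unsplitK; case: i => // j; rewrite mxE.
Qed.

Lemma measurable_rV_addr n (b : 'rV[R]_n) : measurable_fun setT (fun v : 'rV[R]_n => v + b)%R.
Proof.
apply: measurable_fun_mxP => i j; under eq_fun do rewrite mxE.
by apply: measurable_funD => //; exact: measurable_entry.
Qed.

Lemma rV_consD n x y (u v : 'rV[R]_n) :
  (rV_cons (x, u) + rV_cons (y, v) = rV_cons (x + y, u + v))%R.
Proof.
apply/rowP => i; rewrite -[i](@splitK 1 n i) mxE !rV_cons_entry.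
by case: fintype.split => j //=; rewrite mxE.
Qed.

Lemma rV_consE n (v : 'rV[R]_n.+1) : exists x u, v = rV_cons (x, u).
Proof.
exists (v 0 0)%R, (rsubmx (v : 'rV_(1 + n))).
apply/rowP => i; rewrite -[i](@splitK 1 n i) rV_cons_entry.
case: fintype.split => j /=; last by rewrite mxE.
by congr (v _ _); apply/val_inj; rewrite /= ord1.
Qed.

Lemma measurable_rV_consl n (x : R) : measurable_fun setT (fun v : 'rV[R]_n => rV_cons (x, v)).
Proof. exact: measurableT_comp (@measurable_rV_cons R n) (pair1_measurable _). Qed.

Lemma measurable_rV_consr n (v : 'rV[R]_n) : measurable_fun setT (fun x : R => rV_cons (x, v)).
Proof. exact: measurableT_comp (@measurable_rV_cons R n) (pair2_measurable _). Qed.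

(** A translation acts on each coordinate separately, so that Tonelli's theorem
    reduces the claim to the line. *)
Lemma integral_rV_translate n (b : 'rV[R]_n) (f : 'rV[R]_n -> \bar R) :
  measurable_fun setT f -> (forall x, 0 <= f x) ->
  \int[leb n]_v f (v + b)%R = \int[leb n]_v f v.
Proof.
elim: n b f => [|n IH] b f mf f0.
  by apply: eq_integral => v _; congr f; apply/rowP => -[].
have [y [c ->]] := rV_consE b.
pose g x := \int[leb n]_v f (rV_cons (x, v)).
have mg : measurable_fun setT g.
  apply: (measurable_fun_fubini_tonelli_F (f \o @rV_cons R n)) => //=.
  exact: measurableT_comp (@measurable_rV_cons R n).
have -> : \int[leb n.+1]_v f v = \int[mu]_x g x by exact: integral_rVS.
have -> : \int[mu]_x g x = \int[mu]_x g (x * 1 + y)%R.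
  have := @integral_affine R 1 y g (oner_neq0 _) mg.
  rewrite normr1 mul1e; apply => x; exact: integral_ge0.
transitivity (\int[mu]_x \int[leb n]_v f (rV_cons (x, v) + rV_cons (y, c))%R).
  apply: (@integral_rVS n (fun v => f (v + rV_cons (y, c))%R)) => //.
  exact: measurableT_comp mf (measurable_rV_addr _).
apply: eq_integral => x _; rewrite /g mulr1.
under eq_integral do rewrite rV_consD.
apply: (IH c (fun v => f (rV_cons (x + y, v)))%R) => //.
exact: measurableT_comp mf (measurable_rV_consl _).
Qed.

End space.

(** * Linear change of variables *)

Section linear_change_of_variables.
Variable R : realType.
Local Notation mu := (@lebesgue_measure R).
Local Notation leb n := (lebesgue_rV R n).
Local Open Scope ereal_scope.

(** The change of variables for A with Jacobian c. As a property of the pair (A, c)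
    it can be multiplied along a factorization of A. *)
Definition dilates n (A : 'M[R]_n) (c : R) := forall f : 'rV[R]_n -> \bar R,
  measurable_fun setT f -> (forall v, 0 <= f v) ->
  \int[leb n]_v f v = `|c|%:E * \int[leb n]_v f (v *m A)%R.

Lemma dilates_mulmx n (A B : 'M[R]_n) a b :
  dilates A a -> dilates B b -> dilates (A *m B) (a * b).
Proof.
move=> dA dB f mf f0; rewrite (dB f mf f0) (dA (fun v => f (v *m B)%R))//.
  rewrite muleA -EFinM mulrC -normrM; congr (_ * _).
  by apply: eq_integral => v _; rewrite mulmxA.
exact: measurableT_comp mf (measurable_mulmxr _).
Qed.

Lemma rV_cons_mul n (x : R) (v : 'rV[R]_n) (A : 'M[R]_(1 + n)) :
  ((rV_cons (x, v) : 'rV[R]_(1 + n)) *m A = row_mx (const_mx x : 'rV_1) v *m A)%R.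
Proof. by []. Qed.

Lemma measurable_rV_fubini n (f : 'rV[R]_n.+1 -> \bar R) :
  measurable_fun setT f -> (forall v, 0 <= f v) ->
  measurable_fun setT (fun x => \int[leb n]_v f (rV_cons (x, v))).
Proof.
move=> mf f0.
apply: (measurable_fun_fubini_tonelli_F (f \o @rV_cons R n)) => //=.
exact: measurableT_comp (@measurable_rV_cons R n).
Qed.

(** Integrate over the tail first: when the head x is fixed, the tail undergoes D
    followed by the translation by x *: b, which does not change the integral. *)
Lemma dilates_ublock n (a : R) (b : 'rV[R]_n) (D : 'M[R]_n) (c : R) : a != 0%R ->
  dilates D c ->
  @dilates n.+1 (block_mx (a%:M : 'M[R]_1) b 0 D : 'M[R]_(1 + n)) (a * c)%R.
Proof.
move=> a0 dD f mf f0.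
have muE (x : R) (v : 'rV[R]_n) :
    ((rV_cons (x, v) : 'rV[R]_(1 + n)) *m block_mx (a%:M : 'M[R]_1) b 0 D =
     rV_cons (x * a, v *m D + x *: b))%R.
  rewrite rV_cons_mul mul_row_block mulmx0 addr0 addrC.
  rewrite mul_mx_scalar; congr row_mx.
    by apply/matrixP => i j; rewrite !mxE mulrC.
  by congr (_ + _)%R; apply/rowP => i; rewrite !mxE big_ord1 !mxE.
pose g x := \int[leb n]_v f (rV_cons (x, v)).
have mg : measurable_fun setT g by exact: measurable_rV_fubini.
have g0 x : 0 <= g x by exact: integral_ge0.
transitivity (\int[mu]_x g x); first exact: integral_rVS.
rewrite (integral_affine 0 a0 mg g0) normrM EFinM -muleA; congr (_ * _).
pose h (v : 'rV[R]_n.+1) :=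
  f ((v : 'rV[R]_(1 + n)) *m block_mx (a%:M : 'M[R]_1) b 0 D)%R.
have mh : measurable_fun setT h.
  exact: measurableT_comp mf (measurable_mulmxr _).
have h0 v : 0 <= h v by exact: f0.
have -> : \int[leb n.+1]_v h v = \int[mu]_x \int[leb n]_v h (rV_cons (x, v)).
  exact: integral_rVS.
rewrite -ge0_integralZl_EFin//; last 2 first.
- by move=> x _; exact: integral_ge0.
- exact: measurable_rV_fubini.
apply: eq_integral => x _; rewrite addr0 /g /h.
have mfx y : measurable_fun setT (fun v : 'rV[R]_n => f (rV_cons (y, v))).
  exact: measurableT_comp mf (measurable_rV_consl _).
rewrite -(integral_rV_translate (x *: b)%R (mfx _))//.
rewrite (dD (fun v => f (rV_cons (x * a, v + x *: b))%R))//.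
  by congr (_ * _); apply: eq_integral => v _; rewrite muE.
exact: measurableT_comp (mfx _) (measurable_rV_addr _).
Qed.

(** With the tail integrated last: when the tail is fixed, the head is only
    translated. *)
Lemma dilates_lshear n (c : 'cV[R]_n) :
  @dilates n.+1 (block_mx (1%:M : 'M[R]_1) 0 c 1%:M : 'M[R]_(1 + n)) 1.
Proof.
move=> f mf f0; rewrite normr1 mul1e.
have muE (x : R) (v : 'rV[R]_n) :
    ((rV_cons (x, v) : 'rV[R]_(1 + n)) *m block_mx (1%:M : 'M[R]_1) 0 c 1%:M =
     rV_cons (x + (v *m c) 0 0, v))%R.
  rewrite rV_cons_mul mul_row_block !mulmx1 mulmx0 add0r; congr row_mx.
  by apply/matrixP => i j; rewrite !ord1 !mxE.
pose h (v : 'rV[R]_n.+1) :=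
  f ((v : 'rV[R]_(1 + n)) *m block_mx (1%:M : 'M[R]_1) 0 c 1%:M)%R.
have mh : measurable_fun setT h.
  exact: measurableT_comp mf (measurable_mulmxr _).
have h0 v : 0 <= h v by exact: f0.
have swap (k : 'rV[R]_n.+1 -> \bar R) : measurable_fun setT k ->
    (forall v, 0 <= k v) ->
    \int[leb n.+1]_v k v = \int[leb n]_v \int[mu]_x k (rV_cons (x, v)).
  move=> mk k0; rewrite -[RHS](@fubini_tonelli _ _ (measurableTypeR R) 'rV[R]_n R mu (leb n)
    (k \o @rV_cons R n)).
  - exact: integral_rVS.
  - exact: measurableT_comp (@measurable_rV_cons R n).
  - by move=> x; exact: k0.
rewrite (swap f mf f0) -[X in _ = X]/(\int[leb n.+1]_v h v) (swap h mh h0).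
apply: eq_integral => v _.
have mfv : measurable_fun setT (fun x : R => f (rV_cons (x, v))).
  exact: measurableT_comp mf (measurable_rV_consr _).
rewrite (integral_affine ((v *m c) 0 0)%R (oner_neq0 _) mfv)// normr1 mul1e.
by apply: eq_integral => x _; rewrite /h muE mulr1.
Qed.

Lemma dilates1 n : dilates (1%:M : 'M[R]_n) 1.
Proof.
move=> f mf f0; rewrite normr1 mul1e.
by apply: eq_integral => v _; rewrite mulmx1.
Qed.

End linear_change_of_variables.

(** Gaussian elimination. When the upper left entry is not 0, A is a lower shear
    times an upper block matrix whose lower right block is smaller. *)
Theorem dilates_det (R : realType) n (A : 'M[R]_n) :
  A \in unitmx -> dilates A (\det A).
Proof.
elim: n A => [A _|n IH].
  by rewrite det_mx00 (_ : A = 1%:M); [exact: dilates1|apply/matrixP => -[]].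
rewrite -[n.+1]/(1 + n)%N => A uA.
have pivot (B : 'M[R]_(1 + n)) :
    B 0 0 != 0 -> B \in unitmx -> dilates B (\det B).
  move=> B00 uB.
  set a := B 0 0 in B00; pose b := ursubmx B; pose c := a^-1 *: dlsubmx B.
  pose D := drsubmx B - c *m b.
  have BE : B = block_mx (1%:M : 'M[R]_1) 0 c 1%:M *m block_mx a%:M b 0 D.
    rewrite mulmx_block !mul1mx !mul0mx ?mulmx0 !addr0 -[LHS]submxK; congr block_mx.
    - apply/matrixP => i j; rewrite !ord1 !mxE /a mulr1n.
      by congr (B _ _); apply/val_inj.
    - by rewrite mul_mx_scalar scalerA divff// scale1r.
    - by rewrite addrC subrK.
  have dB : \det B = a * \det D.
    by rewrite BE det_mulmx det_lblock det_ublock !det1 !mul1r det_scalar1.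
  have uD : D \in unitmx.
    by move: uB; rewrite !unitmxE dB !unitfE mulf_eq0 => /norP[].
  rewrite dB {1}BE -[X in dilates _ X]mul1r.
  apply: dilates_mulmx; first exact: dilates_lshear.
  exact: dilates_ublock (IH _ uD).
have [A00|A00] := eqVneq (A 0 0) 0; last exact: pivot.
have [i Ai0] : exists i : 'I_n, A (rshift 1 i) 0 != 0.
  apply/existsP; apply: contraLR uA => /existsPn A0.
  rewrite unitmxE unitfE negbK -det_tr (expand_det_row _ 0) big1// => j _.
  rewrite mxE [X in X * _](_ : _ = 0) ?mul0r//.
  case: (@split_ordP 1 n j) => k ->; last by have := A0 k; rewrite negbK => /eqP.
  by rewrite -[RHS]A00; congr (A _ _); apply/val_inj; rewrite /= ord1.
(* Multiplication by S adds row i to the first row, which makes the pivot A i 0. *)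
pose S := block_mx (1%:M : 'M[R]_1) (delta_mx 0 i) 0 1%:M.
have dS : \det S = 1 by rewrite det_ublock !det1 mulr1.
have dilS e : dilates (block_mx (1%:M : 'M[R]_1) e 0 1%:M : 'M[R]_(1 + n)) 1.
  rewrite -[X in dilates _ X]mulr1.
  by apply: dilates_ublock; [exact: oner_neq0|exact: dilates1].
pose S' := block_mx (1%:M : 'M[R]_1) (- delta_mx 0 i) 0 1%:M.
have SA : (S *m A) 0 0 = A (rshift 1 i) 0.
  have SE j : S 0 (rshift 1 j) = (j == i)%:R.
    transitivity (S (lshift n 0) (rshift 1 j)); first by congr (S _ _); apply/val_inj.
    by rewrite block_mxEur mxE eqxx.
  rewrite mxE big_split_ord/= big_ord1 (_ : lshift n 0 = 0); last exact/val_inj.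
  rewrite A00 mulr0 add0r (bigD1 i)//= SE eqxx mul1r big1 ?addr0// => j ji.
  by rewrite SE (negPf ji) mul0r.
have AE : A = S' *m (S *m A).
  rewrite mulmxA mulmx_block !mul1mx !mulmx1 !mulmx0 !mul0mx !addr0 add0r subrr.
  by rewrite -scalar_mx_block mul1mx.
rewrite {1}AE -[X in dilates _ X]mul1r; apply: dilates_mulmx; first exact: dilS.
have -> : \det A = \det (S *m A) by rewrite det_mulmx dS mul1r.
apply: pivot; first by rewrite SA.
by rewrite unitmx_mul uA unitmxE dS unitr1.
Qed.

(** * Products, boxes and balls *)

Lemma le_measureS d (T : measurableType d) (R : realType)
    (mu : {measure set T -> \bar R}) (A B : set T) :
  measurable A -> measurable B -> A `<=` B -> (mu A <= mu B)%E.
Proof. by move=> mA mB; apply: le_measure; exact: mem_set. Qed.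

Section lebesgue_products.
Variable R : realType.
Local Notation mu := (@lebesgue_measure R).
Local Notation leb n := (lebesgue_rV R n).

Lemma measurable_row_mx m n :
  measurable_fun setT (fun p : 'rV[R]_m * 'rV[R]_n => row_mx p.1 p.2).
Proof.
apply: measurable_fun_mxP => i j; under eq_fun do rewrite mxE.
case: fintype.split => k.
- exact: measurableT_comp (measurable_entry _ _) measurable_fst.
- exact: measurableT_comp (measurable_entry _ _) measurable_snd.
Qed.

Lemma row_mx_rV_cons m n (x : R) (u : 'rV[R]_m) (v : 'rV[R]_n) :
  row_mx (rV_cons (x, u)) v = rV_cons (x, row_mx u v).
Proof.
have -> : rV_cons (x, u) = row_mx (const_mx x : 'rV_1) u by [].
have -> : rV_cons (x, row_mx u v) = row_mx (const_mx x : 'rV_1) (row_mx u v) by [].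
rewrite row_mxA; apply/rowP => i; rewrite castmxE/=; congr (row_mx _ _ _ _).
- exact/val_inj.
- exact/val_inj.
Qed.

Lemma integral_rV_add m n (f : 'rV[R]_(m + n) -> \bar R) :
  measurable_fun setT f -> (forall v, (0 <= f v)%E) ->
  (\int[leb (m + n)]_v f v = \int[leb m]_u \int[leb n]_v f (row_mx u v))%E.
Proof.
move=> mf f0.
have mfr k (g : 'rV[R]_(k + n) -> \bar R) : measurable_fun setT g ->
    (forall v, 0 <= g v)%E ->
    measurable_fun setT (fun u : 'rV[R]_k => \int[leb n]_v g (row_mx u v))%E.
  move=> mg g0; apply: (measurable_fun_fubini_tonelli_F
    (fun p : 'rV[R]_k * 'rV[R]_n => g (row_mx p.1 p.2))) => //.
  exact: measurableT_comp mg (@measurable_row_mx k n).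
elim: m f mf f0 => [|m IH] f mf f0.
  transitivity (\int[\d_ (0%R : 'rV[R]_0)]_u \int[leb n]_v f (row_mx u v))%E; last by [].
  rewrite integral_dirac//; last exact: mfr.
  rewrite diracT mul1e; apply: eq_integral => v _; congr f.
  apply/rowP => i; rewrite -[i](@splitK 0 n i) mxE unsplitK.
  by case: fintype.split => [[]//|j]; congr (v _ _); apply/val_inj.
pose g (u : 'rV[R]_m.+1) := (\int[leb n]_v f (row_mx u v))%E.
transitivity (\int[mu]_x \int[leb (m + n)]_w f (rV_cons (x, w)))%E.
  exact: (@integral_rVS R (m + n) f).
transitivity (\int[mu]_x \int[leb m]_u g (rV_cons (x, u)))%E; last first.
  apply/esym/(@integral_rVS R m g); first exact: mfr.
  by move=> u; exact: integral_ge0.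
apply: eq_integral => x _.
have mfx : measurable_fun setT (fun w => f (rV_cons (x, w))).
  exact: measurableT_comp mf (measurable_rV_consl _).
transitivity (\int[leb m]_u \int[leb n]_v f (rV_cons (x, row_mx u v)))%E.
  exact: (IH (fun w => f (rV_cons (x, w))) mfx (fun=> f0 _)).
apply: eq_integral => u _; rewrite /g.
by apply: eq_integral => v _; rewrite row_mx_rV_cons.
Qed.

Lemma measurable_preimage (d d' : measure_display) (T : measurableType d) (T' : measurableType d')
  (f : T -> T') (A : set T') : measurable_fun setT f -> measurable A -> measurable (f @^-1` A).
Proof. by move=> mf mA; rewrite -[X in measurable X]setTI; exact: mf. Qed.

Definition box n (a b : R) : set 'rV[R]_n := [set v | forall i, a <= v 0 i <= b].
Arguments box n a b : clear implicits.

Lemma measurable_box n a b : measurable (box n a b).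
Proof.
rewrite (_ : box _ _ _ = \bigcap_(i in [set: 'I_n]) ((fun v : 'rV[R]_n => v 0 i) @^-1` `[a, b])).
  apply: fin_bigcap_measurable; first exact: finite_finset.
  by move=> i _; apply: measurable_preimage => //; exact: measurable_entry.
apply/seteqP; split => v /= H i; first by move=> _; rewrite /= in_itv/=.
by have := H i Logic.I; rewrite /= in_itv.
Qed.

Lemma lebesgue_box n a b : a <= b -> leb n (box n a b) = ((b - a) ^+ n)%:E.
Proof.
move=> ab; elim: n => [|n IH].
  have -> : leb 0 (box 0 a b) = \d_ (0 : 'rV[R]_0) (box 0 a b) by [].
  by rewrite diracE mem_set// => -[].
rewrite -[LHS]/((mu \x leb n)%E (@rV_cons R n @^-1` box n.+1 a b)).
rewrite (_ : _ @^-1` _ = `[a, b] `*` box n a b); last first.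
  apply/seteqP; split => -[x v] /=; rewrite in_itv/=.
    move=> H; split => [|i].
      have := H (@unsplit 1 n (inl 0)); by rewrite rV_cons_entry.
    have := H (@unsplit 1 n (inr i)); by rewrite rV_cons_entry.
  move=> [xab vab] i; rewrite -[i](@splitK 1 n i) rV_cons_entry.
  by case: fintype.split => j //=; exact: vab.
rewrite [LHS](@product_measure1E _ _ (measurableTypeR R) 'rV[R]_n _ mu (leb n))//; last first.
  exact: measurable_box.
rewrite IH exprS EFinM; congr (_ * _)%E.
rewrite [LHS](lebesgue_measure_itv `[a, b])/= lte_fin.
have [//|] := ltP a b; rewrite le_eqVlt => /orP[/eqP ->|]; first by rewrite subrr.
by rewrite ltNge ab.
Qed.

Lemma dotprod_ge0 n (v : 'rV[R]_n) : 0 <= dotprod v v.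
Proof. by rewrite dotprodE sumr_ge0// => i _; rewrite -expr2 sqr_ge0. Qed.

Lemma enorm_le n (v : 'rV[R]_n) r : 0 <= r -> (enorm v <= r) = (dotprod v v <= r ^+ 2).
Proof.
move=> r0; rewrite -{1}(ger0_norm r0) -sqrtr_sqr /enorm ler_sqrt//.
exact: sqr_ge0.
Qed.

Lemma enorm_ge0 n (v : 'rV[R]_n) : 0 <= enorm v. Proof. exact: sqrtr_ge0. Qed.

Lemma measurable_dotprod d (T : measurableType d) n (f g : T -> 'rV[R]_n) :
  measurable_fun setT f -> measurable_fun setT g ->
  measurable_fun setT (fun x => dotprod (f x) (g x)).
Proof.
move=> mf mg; under eq_fun do rewrite dotprodE.
apply: measurable_sum => i; apply: measurable_funM.
- exact: measurableT_comp (measurable_entry _ _) mf.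
- exact: measurableT_comp (measurable_entry _ _) mg.
Qed.

Lemma measurable_le_cst d (T : measurableType d) (f : T -> R) (r : R) :
  measurable_fun setT f -> measurable [set x | f x <= r].
Proof.
move=> mf; rewrite (_ : [set _ | _] = f @^-1` `]-oo, r]); last first.
  by apply/seteqP; split => x /=; rewrite in_itv.
exact: measurable_preimage.
Qed.

Lemma measurable_eball n (r : R) : measurable [set v : 'rV[R]_n | enorm v <= r].
Proof.
have [r0|r0] := leP 0 r.
  under eq_set do rewrite enorm_le//.
  apply: measurable_le_cst; exact: measurable_dotprod.
rewrite (_ : [set _ | _] = set0)//; apply/seteqP; split => // v /=.
by move=> vr; have := lt_le_trans r0 (le_trans (enorm_ge0 v) vr); rewrite ltxx.
Qed.

Lemma entry_le_enorm n (v : 'rV[R]_n) i : `|v 0 i| <= enorm v.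
Proof.
rewrite -sqrtr_sqr /enorm ler_sqrt ?dotprod_ge0// dotprodE (bigD1 i)//= -expr2.
by rewrite lerDl sumr_ge0// => j _; rewrite -expr2 sqr_ge0.
Qed.

Lemma lebesgue_eball_fin n r : (leb n [set v | enorm v <= r]%R < +oo)%E.
Proof.
have [r0|r0] := leP 0 r; last first.
  rewrite (_ : [set _ | _] = set0) ?measure0//; apply/seteqP; split => // v /=.
  by move=> vr; have := lt_le_trans r0 (le_trans (enorm_ge0 v) vr); rewrite ltxx.
apply: (@le_lt_trans _ _ (leb n (box n (- r) r))); last first.
  by rewrite lebesgue_box ?ltry// (le_trans _ r0)// oppr_le0.
apply: le_measureS; [exact: measurable_eball|exact: measurable_box|].
by move=> v /= vr i; rewrite -ler_norml (le_trans (entry_le_enorm _ _)).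
Qed.

(** The Jacobian is written with the Gram matrix because the two dimensions are
    often only provably equal, and then A has no determinant. *)
Lemma lebesgue_mulmx n m (A : 'M[R]_(n, m)) (S : set 'rV[R]_m) : n = m ->
  \det (A *m A^T) != 0 -> measurable S ->
  leb m S = ((Num.sqrt (\det (A *m A^T)))%:E * leb n [set v | S (v *m A)])%E.
Proof.
move=> nm; subst m; rewrite det_mulmx det_tr -expr2 sqrtr_sqr.
rewrite expf_eq0/= => dA mS.
have uA : A \in unitmx by rewrite unitmxE unitfE.
have := dilates_det uA => /(_ (EFin \o \1_S)).
rewrite integral_indic// setIT => -> //; last first.
- by move=> v; rewrite lee_fin.
- by apply/measurable_EFinP; exact: measurable_indic.
congr (_ * _)%E.
rewrite [RHS](_ : _ = leb n [set v | S (v *m A)])//.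
have mSA : measurable [set v | S (v *m A)].
  exact: measurable_preimage (measurable_mulmxr _) mS.
by rewrite -[in RHS](setIT [set _ | _]) -integral_indic.
Qed.

Lemma lebesgue_eball n r : (0 < n)%N -> 0 <= r ->
  leb n [set v | enorm v <= r] = ((r ^+ n)%:E * unit_ball_volume n)%E.
Proof.
move=> n0; rewrite le_eqVlt => /predU1P[<-|r0].
  (* The exponent n is positive, so the right-hand side is 0, as is the volume of a point. *)
  rewrite expr0n eqn0Ngt n0/= mul0e; apply/eqP; rewrite -measure_le0.
  rewrite (_ : 0%E = leb n (box n 0 0)); last by rewrite lebesgue_box// subrr expr0n eqn0Ngt n0.
  apply: le_measureS; [exact: measurable_eball|exact: measurable_box|].
  move=> v /= v0 i; have := le_trans (entry_le_enorm v i) v0.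
  by rewrite normr_le0 => /eqP ->; rewrite lexx.
have := @lebesgue_mulmx n n (r%:M) _ erefl _ (@measurable_eball n r).
rewrite tr_scalar_mx -scalar_mxM det_scalar -expr2 exprAC sqrtr_sqr.
rewrite ger0_norm ?exprn_ge0 ?(ltW r0)// => ->; last first.
  by rewrite !expf_eq0 (gt_eqF r0) !andbF.
congr (_ * _)%E; rewrite /unit_ball_volume; congr (leb n _).
apply/seteqP; split => v /=; rewrite mul_mx_scalar !enorm_le ?(ltW r0)//;
  rewrite linearZ/= dotprodC linearZ/= /GRing.scale/= mulrA -expr2 expr1n.
  by rewrite ger_pMr ?exprn_gt0.
by rewrite ger_pMr ?exprn_gt0.
Qed.

End lebesgue_products.
Arguments box {R} n a b.

(** * Orthogonal projections *)

Section orthogonal_projections.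
Variables (R : realType) (n : nat).
Implicit Types (W M L : {vspace 'rV[R]_n}) (v : 'rV[R]_n).

Definition oproj W : 'M[R]_n := (onb W)^T *m onb W.

Lemma onbK W : onb W *m (onb W)^T = 1%:M.
Proof. by have [] := onbP W. Qed.

Lemma tr_proj W : (oproj W)^T = oproj W.
Proof. by rewrite /oproj trmx_mul trmxK. Qed.

Lemma proj_idem W : oproj W *m oproj W = oproj W.
Proof. by rewrite /oproj mulmxA -(mulmxA _ (onb W)) onbK mulmx1. Qed.

Lemma mem_onb_mul W (c : 'rV[R]_(\dim W)) : c *m onb W \in W.
Proof.
rewrite mulmx_sum_row; apply: memv_suml => i _.
by apply: memvZ; have [_] := onbP W; exact.
Qed.

Lemma mem_mul_proj W v : v *m oproj W \in W.
Proof. by rewrite mulmxA mem_onb_mul. Qed.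

Lemma mem_projE W v : (v \in W) = (v *m oproj W == v).
Proof.
apply/idP/eqP => [|<-]; last exact: mem_mul_proj.
pose X := [tuple row i (onb W) | i < \dim W].
have XE (i : 'I_(\dim W)) : X`_i = row i (onb W) by rewrite -tnth_nth tnth_mktuple.
have X_free : free X.
  apply/freeP => k k0 i.
  have : (\row_j k j) *m onb W = 0.
    by rewrite -[RHS]k0 mulmx_sum_row; apply: eq_bigr => j _; rewrite XE mxE.
  move=> /(congr1 (mulmx^~ (onb W)^T)); rewrite -mulmxA onbK mulmx1 mul0mx.
  by move=> /rowP /(_ i); rewrite !mxE.
have WX : W = <<X>>%VS.
  apply/esym/eqP; rewrite eqEdim; apply/andP; split.
    apply/span_subvP => u /tnthP[i ->]; rewrite tnth_mktuple.
    by have [_] := onbP W; exact.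
  by move: X_free; rewrite /free => /eqP ->; rewrite size_tuple.
rewrite {1}WX => /coord_span ->; under eq_bigr do rewrite XE.
rewrite mulmx_suml; apply: eq_bigr => i _.
by rewrite -scalemxAl /oproj mulmxA -row_mul onbK row1 -rowE.
Qed.

Lemma mem_orthocomp_proj W v : (v \in orthocomp W) = (v *m oproj W == 0).
Proof.
apply/idP/eqP => [/mem_orthocomp vW|v0].
  rewrite mulmxA (_ : v *m (onb W)^T = 0) ?mul0mx//.
  apply/rowP => i; rewrite [RHS]mxE -[RHS](vW (row i (onb W))).
    by rewrite dotprodE mxE; apply: eq_bigr => j _; rewrite !mxE mulrC.
  by have [_] := onbP W; exact.
apply/mem_orthocomp => w; rewrite mem_projE => /eqP <-.
by rewrite dotprodC /dotprod (trmx_mul w) tr_proj mulmxA v0 mul0mx mxE.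
Qed.

Lemma proj_orthocomp W : oproj (orthocomp W) = 1%:M - oproj W.
Proof.
apply/row_matrixP => i; rewrite !rowE mulmxBr mulmx1.
set v := delta_mx 0 i.
have vW : v - v *m oproj W \in orthocomp W.
  by rewrite mem_orthocomp_proj mulmxBl -mulmxA proj_idem subrr.
have -> : v *m oproj (orthocomp W) = (v - v *m oproj W) *m oproj (orthocomp W).
  rewrite [RHS]mulmxBl (_ : v *m oproj W *m _ = 0) ?subr0//.
  apply/eqP; rewrite -mem_orthocomp_proj; apply/mem_orthocomp => w wW.
  rewrite dotprodC; move/mem_orthocomp : wW; apply; exact: mem_mul_proj.
by apply/eqP; rewrite -mem_projE.
Qed.

(** The dimension of a subspace is the trace of the projection onto it. *)
Lemma dim_orthocomp W : (\dim (orthocomp W) + \dim W = n)%N.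
Proof.
have trE U : \tr (oproj U) = (\dim U)%:R by rewrite mxtrace_mulC onbK mxtrace1.
apply/eqP; rewrite -(eqr_nat R) natrD -!trE proj_orthocomp linearB/= mxtrace1.
by rewrite subrK.
Qed.

(** As a quadratic form in v, the sum of the squared distances of v to M and to L. *)
Definition gap M L : 'M[R]_n := 1%:M - oproj M + (1%:M - oproj L).

Lemma dotprod_proj W v : dotprod v (v *m oproj W) = dotprod (v *m oproj W) (v *m oproj W).
Proof.
rewrite /dotprod !(trmx_mul v (oproj W)) tr_proj !(mulmxA _ (oproj W)); congr (fun_of_matrix _ _ _).
by rewrite -(mulmxA v (oproj W) (oproj W)) proj_idem.
Qed.

Lemma dotprod_eq0 m (v : 'rV[R]_m) : (dotprod v v == 0) = (v == 0).
Proof.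
apply/eqP/eqP => [v0|->]; last by rewrite /dotprod mul0mx mxE.
by apply/eqP; apply: contra_eqT v0 => /dotprod_gt0; rewrite lt_neqAle eq_sym => /andP[].
Qed.

(** A vector of the kernel has distance 0 to both M and L. *)
Lemma gap_unit M L : reflect (general_position M L) (gap M L \in unitmx).
Proof.
rewrite unitmxE unitfE; apply: (iffP idP) => [S0|ML].
  apply/eqP; rewrite -subv0; apply/subvP => v; rewrite memv_cap memv0.
  rewrite !mem_projE => /andP[/eqP vM /eqP vL]; apply: contraNT S0 => v0.
  apply/det0P; exists v => //.
  by rewrite mulmxDr !mulmxBr mulmx1 vM vL subrr addr0.
apply/negP => /det0P[v v0 vS]; move/negP : v0; apply.
have : dotprod v (v *m gap M L) = 0 by rewrite vS /dotprod trmx0 mulmx0 mxE.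
rewrite /gap -!proj_orthocomp mulmxDr linearD/= !dotprod_proj.
move=> /eqP; rewrite paddr_eq0 ?dotprod_ge0// !dotprod_eq0 !proj_orthocomp.
rewrite !mulmxBr mulmx1 !subr_eq0 ![v == _]eq_sym -!mem_projE -memv_cap.
by rewrite ML memv0 eq_sym.
Qed.

(** Sylvester's determinant identity: both determinants are, up to a power of a,
    that of the block matrix X, from which either diagonal block can be eliminated. *)
Lemma det_scalar_sub_mul p (C : 'M[R]_(p, n)) (a : R) : a != 0 ->
  a ^+ p * \det (a%:M - C^T *m C) = a ^+ n * \det (a%:M - C *m C^T).
Proof.
move=> a0; pose X := block_mx a%:M C^T C 1%:M.
have -> : \det (a%:M - C^T *m C) = \det X.
  have -> : X = block_mx 1%:M C^T 0 1%:M *m block_mx (a%:M - C^T *m C) 0 C 1%:M.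
    by rewrite mulmx_block !mul1mx !mul0mx !mulmx1 !add0r subrK.
  by rewrite det_mulmx det_ublock det_lblock !det1 !mulr1 mul1r.
have : \det (block_mx 1%:M 0 (- a^-1 *: C) 1%:M *m X) = \det X.
  by rewrite det_mulmx det_lblock !det1 !mul1r.
move=> <-; rewrite mulmx_block !mul1mx !mul0mx !addr0.
rewrite mul_mx_scalar scalerA mulrN divff// scaleN1r addNr det_ublock.
rewrite det_scalar mulrCA; congr (_ * _); rewrite -detZ; congr (\det _).
by rewrite scalerDr -scalemxAl scalerA mulrN divff// scaleN1r addrC scale_scalar_mx mulr1.
Qed.

Definition frame M L := col_mx (onb M) (onb L).

(** With C the frame, gap M L is 2 - C^T C, which Sylvester's identity exchanges
    for 2 - C C^T. As both bases are orthonormal, the diagonal blocks of C C^T are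
    identities, so that 2 - C C^T differs from C C^T by the sign of the other two. *)
Lemma det_frame M L :
  \det (frame M L *m (frame M L)^T) =
  2 ^+ (\dim M + \dim L) / 2 ^+ n * \det (gap M L).
Proof.
have two0 : (2 : R) != 0 by [].
apply: (@mulfI _ (2 ^+ n)); first by rewrite expf_neq0.
rewrite mulrA mulrCA divff ?expf_neq0// mulr1.
have -> : gap M L = 2%:M - (frame M L)^T *m frame M L.
  rewrite /frame tr_col_mx mul_row_col -/(oproj M) -/(oproj L) /gap.
  by rewrite addrACA -opprD -raddfD/=.
rewrite det_scalar_sub_mul//; congr (_ * _).
(* Conjugation by D changes the sign of the off-diagonal blocks. *)
pose D : 'M[R]_(\dim M + \dim L) := block_mx 1%:M 0 0 (- 1%:M).
have DD : \det D * \det D = 1.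
  rewrite det_ublock det1 mul1r -det_mulmx mulmxN mulNmx opprK mulmx1 det1.
  by [].
have -> : 2%:M - frame M L *m (frame M L)^T = D *m (frame M L *m (frame M L)^T) *m D.
  rewrite /frame tr_col_mx mul_col_row !onbK [2%:M]scalar_mx_block.
  rewrite opp_block_mx add_block_mx !mulmx_block.
  rewrite !mul1mx !mulmx1 !mul0mx !mulmx0 !addr0 !add0r.
  rewrite ?mulNmx ?mulmxN ?mul1mx ?mulmx1 ?opprK.
  by congr block_mx; rewrite -raddfB/= -[2]/(1 + 1) addrK.
by rewrite !det_mulmx mulrAC DD mul1r.
Qed.

End orthogonal_projections.

(** * The subspace determinant *)

Section subspace_determinant.
Variables (R : realType) (n : nat).
Implicit Types (W M L : {vspace 'rV[R]_n}) (v : 'rV[R]_n).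

(** The parallelepiped is the preimage of the unit cube under the inverse of A. *)
Lemma lebesgue_parallelepiped p m (A : 'M[R]_(p, m)) : p = m ->
  \det (A *m A^T) != 0 ->
  lebesgue_rV R m (parallelepiped A) = (Num.sqrt (\det (A *m A^T)))%:E.
Proof.
move=> pm; subst p => dA.
have uA : A \in unitmx.
  by move: dA; rewrite det_mulmx det_tr mulf_eq0 orbb unitmxE unitfE.
have E : parallelepiped A = (fun y => y *m invmx A) @^-1` box m 0 1.
  apply/seteqP; split => y /=.
    by move=> [z z01 <-]; rewrite mulmxK.
  by move=> y01; exists (y *m invmx A) => //; rewrite mulmxKV.
rewrite (lebesgue_mulmx (A := A))//; last first.
  by rewrite E; exact: measurable_preimage (measurable_mulmxr _) (measurable_box _ _).
rewrite (_ : [set v | _] = box m 0 1) ?lebesgue_box ?ler01// ?subr0 ?expr1n ?mule1//.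
by rewrite E; apply/seteqP; split => y /=; rewrite mulmxK.
Qed.

Lemma dim_sum_gp M L : reflect (general_position M L)
  (\dim (M + L) == \dim M + \dim L)%N.
Proof.
rewrite -dimv_sum_cap -[X in X == _]addn0 eqn_add2l eq_sym dimv_eq0.
exact: eqP.
Qed.

(** The right-hand side depends on M and L through their orthogonal projections
    only, which makes the subspace determinant a measurable function. *)
Lemma subspace_detE M L : subspace_det M L =
  (Num.sqrt (2 ^+ (\dim M + \dim L) / 2 ^+ n * \det (gap M L)))%:E.
Proof.
rewrite /subspace_det; case: dim_sum_gp => ML; last first.
  have : gap M L \notin unitmx by apply/gap_unit.
  by rewrite unitmxE unitfE negbK => /eqP ->; rewrite mulr0 sqrtr0.
rewrite -det_frame /lebesgue_on /pushforward -/(frame M L).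
set N := onb (M + L); set C := frame M L.
have CN : C = C *m N^T *m N.
  rewrite -mulmxA -/(oproj _); apply/row_matrixP => i; rewrite row_mul.
  apply/esym/eqP; rewrite -mem_projE /C /frame -[i]splitK.
  case: fintype.split => j /=; rewrite ?col_mxKu ?rowKu ?rowKd.
    by apply: (subvP (addvSl M L)); have [_] := onbP M; exact.
  by apply: (subvP (addvSr M L)); have [_] := onbP L; exact.
have CC : C *m C^T = (C *m N^T) *m (C *m N^T)^T.
  by rewrite {1 2}CN trmx_mul -mulmxA (mulmxA N) onbK mul1mx.
have dC : \det (C *m C^T) != 0.
  rewrite det_frame !mulf_neq0 ?invr_neq0 ?expf_neq0//.
  by move/gap_unit : ML; rewrite unitmxE unitfE.
rewrite CC -lebesgue_parallelepiped; last 2 first.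
- by apply/esym/eqP/dim_sum_gp.
- by rewrite -CC.
congr (lebesgue_rV R _ _); apply/seteqP; split => y /=.
  move=> [z z01]; rewrite [in LHS]CN mulmxA => yN; exists z => //.
  have := congr1 (mulmx^~ N^T) yN; rewrite -!mulmxA onbK !mulmx1.
  by rewrite !mulmxA.
by move=> [z z01 <-]; exists z => //; rewrite [in LHS]CN !mulmxA.
Qed.

Lemma subspace_det_ge0 M L : (0 <= subspace_det M L)%E.
Proof. by rewrite subspace_detE lee_fin sqrtr_ge0. Qed.

End subspace_determinant.

(** * Borel sets of the space of row vectors *)

Section borel_rV.
Variables (R : realType).

Lemma continuous_rVP (T : topologicalType) n (f : T -> 'rV[R]_n) :
  (forall i, continuous (fun x => f x 0 i)) -> continuous f.
Proof.
move=> cf x A [P nP sPA];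
apply: (@filterS _ _ _ (f @^-1` [set v : 'rV[R]_n | forall i, P 0 i (v 0 i)])).
  by move=> y /= Py; apply: sPA => i j; rewrite ord1.
apply: filter_forall => i; exact: (cf i x _ (nP 0 i)).
Qed.

Lemma continuous_sum_real (T : topologicalType) (I : finType) (F : I -> T -> R) :
  (forall i, continuous (F i)) -> continuous (fun x => \sum_i F i x).
Proof. by move=> cF; apply: continuous_big => //; exact: add_continuous. Qed.

Lemma continuous_mulmxr m n (A : 'M[R]_(m, n)) : continuous (fun v : 'rV[R]_m => v *m A).
Proof.
apply: continuous_rVP => i.
rewrite (_ : (fun _ => _) = (fun v : 'rV[R]_m => \sum_j v 0 j * A j i)); last first.
  by apply/funext => v; rewrite mxE.
apply: continuous_sum_real => j v; exact: cvgMr_tmp (@coord_continuous _ _ _ 0 j v).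
Qed.

Lemma continuous_sqnorm_sub n (z : 'rV[R]_n) :
  continuous (fun v : 'rV[R]_n => dotprod (v - z) (v - z)).
Proof.
under eq_fun do rewrite dotprodE.
have cE i : continuous (fun v : 'rV[R]_n => (v - z) 0 i).
  under eq_fun do rewrite !mxE.
  by move=> w; exact: cvgB (@coord_continuous _ _ _ 0 i w) (cvg_cst _).
by apply: continuous_sum_real => i w; exact: cvgM (cE i w) (cE i w).
Qed.

Lemma compact_sqnorm_bounded n (K : set 'rV[R]_n) : compact K ->
  exists2 C : R, 0 <= C & forall v, K v -> dotprod v v <= C.
Proof.
move=> cK; have cf : continuous (fun v : 'rV[R]_n => dotprod v v).
  rewrite (_ : (fun _ => _) = (fun v => dotprod (v - 0) (v - 0))).
    exact: continuous_sqnorm_sub.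
  by apply/funext => v; rewrite subr0.
have : compact ((fun v : 'rV[R]_n => dotprod v v) @` K).
  by apply: continuous_compact => //; exact: continuous_subspaceT.
move=> /compact_bounded[M [_ KM]]; exists (`|M| + 1); first by rewrite addr_ge0.
move=> v Kv; apply: le_trans (ler_norm _) _; apply: KM; last by exists v.
by rewrite ltr_pwDr// ler_norm.
Qed.

Lemma compact_eball n (z : 'rV[R]_n) (r : R) : compact [set v : 'rV[R]_n | enorm (v - z) <= r].
Proof.
apply: (@subclosed_compact _ _
  [set v : 'rV[R]_n | forall i, `[z 0 i - r, z 0 i + r]%classic (v ord0 i)]).
- have [r0|r0] := leP 0 r; last first.
    rewrite (_ : [set _ | _] = set0); first exact: closed0.
    apply/seteqP; split => // v /=.
    by move=> vr; have := lt_le_trans r0 (le_trans (enorm_ge0 _) vr); rewrite ltxx.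
  rewrite (_ : [set _ | _] =
    (fun v : 'rV[R]_n => dotprod (v - z) (v - z)) @^-1` [set x | x <= r ^+ 2]).
    apply: closed_comp; last exact: closed_le.
    by move=> v _; exact: continuous_sqnorm_sub.
  by apply/seteqP; split => v /=; rewrite enorm_le.
- apply: (@rV_compact _ _ (fun i => `[z 0 i - r, z 0 i + r]%classic)) => i.
  exact: segment_compact.
- move=> v /= vr i; rewrite in_itv/= -ler_distl.
  by have := le_trans (entry_le_enorm (v - z) i) vr; rewrite !mxE.
Qed.

Lemma ball_rV n (x y : 'rV[R]_n) (e : R) : 0 < e ->
  ball x e y <-> forall i, `|x 0 i - y 0 i| < e.
Proof.
move=> e0; split.
  move=> [_ xy] i; exact: (xy 0 i).
by move=> xy; split => // i j; rewrite ord1; exact: xy.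
Qed.

Lemma measurable_ball_rV n (x : 'rV[R]_n) (e : R) : 0 < e -> measurable (ball x e).
Proof.
move=> e0; rewrite (_ : ball x e = \bigcap_(i in [set: 'I_n])
   ((fun v : 'rV[R]_n => v 0 i) @^-1` ball (x 0 i) e)).
  apply: fin_bigcap_measurable; first exact: finite_finset.
  move=> i _; apply: measurable_preimage; first exact: measurable_entry.
  exact: measurable_ball.
apply/seteqP; split => v /=.
  by move=> /(ball_rV _ _ e0) xv i _; exact: xv.
by move=> xv; apply/ball_rV => // i; exact: xv.
Qed.

(** A compact set is closed, hence the intersection over m of finite covers by balls
    of radius 1 / m.+1, and a ball of the supremum norm is a box. *)
Lemma compact_measurable_rV n (K : set 'rV[R]_n) : compact K -> measurable K.
Proof.
move=> cK.
have e0 m : 0 < m.+1%:R^-1 :> R by rewrite invr_gt0 ltr0n.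
have /choice[F FK] : forall m : nat, exists F : {fset 'rV[R]_n},
    (forall x, x \in F -> K x) /\ K `<=` \bigcup_(x in [set` F]) ball x m.+1%:R^-1.
  move=> m; have := cK; rewrite compact_cover.
  move=> /(_ _ K (fun x => ball x m.+1%:R^-1) (fun x _ => ball_open _ _)) [].
    by move=> x Kx; exists x => //; exact: ballxx.
  move=> F FK KF; exists F; split => //.
  by move=> x xF; exact: set_mem (FK x xF).
have -> : K = \bigcap_m \bigcup_(x in [set` F m]) ball x m.+1%:R^-1.
  apply/seteqP; split; first by move=> x Kx m _; have [_] := FK m; exact.
  have clK : closed K by apply: compact_closed => //; exact: norm_hausdorff.
  move=> x xF; apply: clK => B /nbhs_ballP[e /= e_gt0 xeB].
  have [m me] := ltr_add_invr (y := 0) e_gt0; rewrite add0r in me.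
  have [y yF xy] := xF m Logic.I; exists y; split; first by have [+ _] := FK m; exact.
  by apply: xeB; apply: ball_sym; exact: le_ball (ltW me) _ xy.
apply: bigcap_measurableType => m _.
apply: fin_bigcup_measurable; first exact: finite_fset.
by move=> x _; exact: measurable_ball_rV.
Qed.

End borel_rV.

(** * Measurable coordinates on the space of flats *)

Section orthogonal_rejection.
Variables (R : realType) (n : nat).
Implicit Types (W M L : {vspace 'rV[R]_n}) (v : 'rV[R]_n).

(** The vector rejection: projection along W onto its orthogonal complement. *)
Definition rej W : 'M[R]_n := 1%:M - oproj W.

Lemma tr_rej W : (rej W)^T = rej W.
Proof. by rewrite /rej linearB/= trmx1 tr_proj. Qed.

Lemma rej_idem W : rej W *m rej W = rej W.
Proof. by rewrite /rej -proj_orthocomp proj_idem. Qed.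

Lemma mem_rej W v : (v \in W) = (v *m rej W == 0).
Proof. by rewrite mulmxBr mulmx1 subr_eq0 eq_sym -mem_projE. Qed.

Lemma dotprod_rejC W u v : dotprod (u *m rej W) v = dotprod u (v *m rej W).
Proof. by rewrite /dotprod (trmx_mul v) tr_rej mulmxA. Qed.

Lemma dotprodDr (u v w : 'rV[R]_n) : dotprod w (u + v) = dotprod w u + dotprod w v.
Proof. exact: linearD. Qed.

Lemma dotprodNr (u v : 'rV[R]_n) : dotprod u (- v) = - dotprod u v.
Proof. exact: linearN. Qed.

Lemma dotprodNl (u v : 'rV[R]_n) : dotprod (- u) v = - dotprod u v.
Proof. by rewrite dotprodC dotprodNr dotprodC. Qed.

Lemma dotprodDl (u v w : 'rV[R]_n) : dotprod (u + v) w = dotprod u w + dotprod v w.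
Proof. by rewrite dotprodC dotprodDr ![dotprod w _]dotprodC. Qed.

Lemma dotprodBl (u v w : 'rV[R]_n) : dotprod (u - v) w = dotprod u w - dotprod v w.
Proof. by rewrite dotprodDl dotprodNl. Qed.

Lemma dotprodBr (u v w : 'rV[R]_n) : dotprod w (u - v) = dotprod w u - dotprod w v.
Proof. exact: linearB. Qed.

Lemma dotprod_rej_le W v : dotprod (v *m rej W) (v *m rej W) <= dotprod v v.
Proof.
rewrite {3 4}(_ : v = v *m oproj W + v *m rej W); last by rewrite -mulmxDr addrC subrK mulmx1.
rewrite dotprodDl !dotprodDr [dotprod (v *m rej W) (v *m oproj W)]dotprodC.
rewrite (_ : dotprod (v *m oproj W) (v *m rej W) = 0).
  by rewrite addr0 add0r lerDr dotprod_ge0.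
rewrite dotprodC dotprod_rejC -mulmxA [X in v *m X](_ : _ = 0).
  by rewrite mulmx0 /dotprod trmx0 mulmx0 mxE.
by rewrite /rej mulmxBr mulmx1 proj_idem subrr.
Qed.

End orthogonal_rejection.

Section flats.
Context {R : realType} {d k : nat} {kd : (2 * k < d)%N}.
Implicit Types (L : grassmannian R kd) (E F : flat R kd) (x y z : 'rV[R]_d).

Lemma flat_translateP E : exists L x, E = translate L x.
Proof.
case: E => S [L [x SE]]; exists L, x; rewrite /translate.
by subst S; congr Flat; exact: Prop_irrelevance.
Qed.

Lemma flat_eqP E F : flat_points E = flat_points F -> E = F.
Proof.
case: E F => S HS [T HT] /= ST; subst T; congr Flat; exact: Prop_irrelevance.
Qed.

Lemma mem_translate L x z : flat_points (translate L x) z <-> z *m rej L = x *m rej L.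
Proof.
split => [[v /= vL <-]|zx].
  by move: vL; rewrite mem_rej mulmxDl => /eqP ->; rewrite add0r.
exists (z - x); last by rewrite subrK.
by rewrite /= mem_rej mulmxBl zx subrr.
Qed.

Definition flat_dir E : grassmannian R kd := sval (cid (flat_translateP E)).

Definition flat_base E : 'rV[R]_d := sval (cid (svalP (cid (flat_translateP E)))).

Definition flat_rej E : 'M[R]_d := rej (flat_dir E).

(** The point of E closest to the origin, so that it depends on E only, not on the
    base point. *)
Definition foot E : 'rV[R]_d := flat_base E *m flat_rej E.

Lemma translate_dir_base E : E = translate (flat_dir E) (flat_base E).
Proof. exact: (svalP (cid (svalP (cid (flat_translateP E))))). Qed.

Lemma mem_flat E z : flat_points E z <-> z *m flat_rej E = foot E.
Proof. by rewrite {1}(translate_dir_base E) mem_translate. Qed.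

Lemma translate_dir_sub L M x y : translate L x = translate M y -> (L <= M)%VS.
Proof.
move=> LM; apply/subvP => v vL.
have : flat_points (translate M y) (v + x) by rewrite -LM; exists v.
have : flat_points (translate M y) x by rewrite -LM; exists 0; rewrite ?add0r//=; exact: mem0v.
rewrite !mem_translate => xy; rewrite mulmxDl xy mem_rej => /eqP.
by rewrite -[X in _ == X]add0r (inj_eq (addIr _)).
Qed.

Lemma flat_dir_translate L x : linear_subspace (flat_dir (translate L x)) = L.
Proof.
have E := translate_dir_base (translate L x).
by apply/eqP; rewrite eqEsubv (translate_dir_sub E) (translate_dir_sub (esym E)).
Qed.

Lemma flat_rej_translate L x : flat_rej (translate L x) = rej L.
Proof. by rewrite /flat_rej flat_dir_translate. Qed.

Lemma foot_translate L x : foot (translate L x) = x *m rej L.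
Proof.
have : flat_points (translate L x) x by apply/mem_translate.
by move=> /mem_flat <-; rewrite flat_rej_translate.
Qed.

Lemma foot_rej E : foot E *m flat_rej E = foot E.
Proof. by rewrite /foot -mulmxA rej_idem. Qed.

Lemma flat_rej_foot_inj E F : flat_rej E = flat_rej F -> foot E = foot F -> E = F.
Proof.
move=> ErF EfF; apply: flat_eqP; apply/seteqP; split => z /mem_flat zE;
  apply/mem_flat; [by rewrite -ErF zE|by rewrite ErF zE].
Qed.

Definition sqdist z E : R := dotprod (z *m flat_rej E - foot E) (z *m flat_rej E - foot E).

(** The point of E closest to z is z - (z *m flat_rej E - foot E). Thus sublevel sets
    of sqdist z are hitting sets of balls, which belong to the generators of the
    sigma-algebra of flats. *)
Lemma hit_eball E z r : 0 <= r ->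
  ([set v | enorm (v - z) <= r] `&` flat_points E !=set0) <-> sqdist z E <= r ^+ 2.
Proof.
move=> r0; split => [[y [/= yz /mem_flat yE]]|zr].
  rewrite enorm_le// in yz; apply: le_trans yz.
  rewrite /sqdist -yE -mulmxBl -(opprB y z) mulNmx.
  by rewrite dotprodNl dotprodNr opprK dotprod_rej_le.
exists (z - (z *m flat_rej E - foot E)); split.
  rewrite /= addrC addKr enorm_le// dotprodNl dotprodNr opprK.
  exact: zr.
by apply/mem_flat; rewrite mulmxBl mulmxBl foot_rej -mulmxA rej_idem subKr.
Qed.

Lemma measurable_sqdist z : measurable_fun setT (sqdist z).
Proof.
move=> mD; apply: (measurability _ (RGenOInfty.measurableE R)) => // _ [_ [a ->] <-].
rewrite setTI (_ : _ @^-1` _ = ~` [set E | sqdist z E <= a]); last first.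
  by apply/seteqP; split => E /=; rewrite in_itv/= andbT ltNge => /negP.
apply: measurableC; have [a0|a0] := leP 0 a; last first.
  rewrite (_ : [set _ | _] = set0)//; apply/seteqP; split => // E /= Ea.
  have := le_trans (dotprod_ge0 (z *m flat_rej E - foot E)) Ea.
  by rewrite leNgt a0.
apply: sub_sigma_algebra; exists [set v | enorm (v - z) <= Num.sqrt a].
  exact: compact_eball.
apply/seteqP; split => E /=.
  by move/(hit_eball _ _ (sqrtr_ge0 a)); rewrite sqr_sqrtr.
by move=> Ea; apply/(hit_eball _ _ (sqrtr_ge0 a)); rewrite sqr_sqrtr.
Qed.

Lemma delta_rej E i j :
  dotprod (delta_mx 0 i *m flat_rej E) (delta_mx 0 j *m flat_rej E) = flat_rej E i j.
Proof.
rewrite dotprod_rejC -mulmxA rej_idem dotprodC /dotprod -rowE trmx_delta -colE.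
rewrite mxE mxE; have /matrixP/(_ j i) := tr_rej (flat_dir E).
by rewrite mxE => <-.
Qed.

Lemma delta_foot E i : dotprod (delta_mx 0 i *m flat_rej E) (foot E) = foot E 0 i.
Proof.
by rewrite dotprod_rejC foot_rej dotprodC /dotprod trmx_delta -colE mxE.
Qed.

(** Polarization of the quadratic polynomial sqdist, of which flat_rej E gives the
    quadratic and foot E the linear part. *)
Lemma flat_rejE E i j : flat_rej E i j =
  (sqdist (delta_mx 0 i + delta_mx 0 j) E - sqdist (delta_mx 0 i) E
   - sqdist (delta_mx 0 j) E + sqdist 0 E) / 2.
Proof.
rewrite -delta_rej /sqdist mulmxDl mul0mx sub0r.
set a := delta_mx 0 i *m _; set b := delta_mx 0 j *m _; set p := foot E.
rewrite !(dotprodBl, dotprodDl, dotprodNl, dotprodBr, dotprodDr, dotprodNr).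
rewrite (dotprodC b a) (dotprodC p a) (dotprodC p b).
by field.
Qed.

Lemma footE E i : foot E 0 i =
  (sqdist (- delta_mx 0 i) E - sqdist (delta_mx 0 i) E) / 4.
Proof.
rewrite -delta_foot /sqdist mulNmx.
set a := delta_mx 0 i *m _; set p := foot E.
rewrite !(dotprodBl, dotprodNl, dotprodBr, dotprodNr) (dotprodC p a).
by field.
Qed.

Lemma measurable_flat_rej : measurable_fun setT flat_rej.
Proof.
apply: measurable_fun_mxP => i j; under eq_fun do rewrite flat_rejE.
apply: measurable_funM => //; apply: measurable_funD; last exact: measurable_sqdist.
by apply: measurable_funB; [apply: measurable_funB|]; exact: measurable_sqdist.
Qed.

Lemma measurable_foot : measurable_fun setT foot.
Proof.
apply: measurable_fun_mxP => i j; rewrite ord1; under eq_fun do rewrite footE.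
by apply: measurable_funM => //; apply: measurable_funB; exact: measurable_sqdist.
Qed.

(** The flat L + x hits C exactly when x and some point of C have the same
    rejection from L, and the rejections of the points of C form a compact set. *)
Lemma measurable_translate L : measurable_fun setT (translate L).
Proof.
apply: (measurability (@flat_hits R d k kd)) => //.
move=> _ [_ [C cC <-] <-]; rewrite setTI.
rewrite (_ : _ @^-1` _ = (fun x => x *m rej L) @^-1` ((fun x => x *m rej L) @` C)).
  apply: measurable_preimage; first exact: measurable_mulmxr.
  apply: compact_measurable_rV; apply: continuous_compact => //.
  by apply: continuous_subspaceT; exact: continuous_mulmxr.
apply/seteqP; split => x /=.
  by move=> [y [Cy /mem_translate yx]]; exists y.
by move=> [y Cy yx]; exists y; split => //; apply/mem_translate.
Qed.

Lemma measurable_translate0 : measurable_fun setT (fun L : grassmannian R kd => translate L 0).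
Proof.
apply: (measurability (@flat_hits R d k kd)) => //.
move=> _ [_ [C cC <-] <-]; rewrite setTI; apply: sub_sigma_algebra.
exists C => //; apply/seteqP; split => L /=.
  move=> [x Cx xL]; exists x; split => //; apply/mem_translate.
  by rewrite mul0mx; apply/eqP; rewrite -mem_rej.
move=> [x [Cx /mem_translate xL]]; exists x => //.
by rewrite mem_rej xL mul0mx.
Qed.

Lemma measurable_rej : measurable_fun setT (fun L : grassmannian R kd => rej L).
Proof.
under eq_fun => L do rewrite -(flat_rej_translate L 0).
exact: measurableT_comp measurable_flat_rej measurable_translate0.
Qed.

End flats.

(** * Measurable matrix operations *)

Section measurable_algebra.
Context {R : realType} {d : measure_display} {T : measurableType d}.

Lemma measurable_mxE m n (f : T -> 'M[R]_(m, n)) i j :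
  measurable_fun setT f -> measurable_fun setT (fun x => f x i j).
Proof. by move=> mf; exact: measurableT_comp (measurable_entry _ _) mf. Qed.

Lemma measurable_inv (f : T -> R) :
  measurable_fun setT f -> measurable_fun setT (fun x => (f x)^-1).
Proof.
(* The inverse of a square is a power function; the factor f x gives back the sign. *)
move=> mf; rewrite (_ : (fun _ => _) = (fun x => f x * powR (f x ^+ 2) (-1))).
  apply: measurable_funM => //.
  exact: measurableT_comp (measurable_powR (-1)) (measurable_funX 2 mf).
apply/funext => x; rewrite powR_inv1 ?sqr_ge0//.
have [->|x0] := eqVneq (f x) 0; first by rewrite invr0 mul0r.
by rewrite expr2 invfM mulrA divff// mul1r.
Qed.

Lemma measurable_sqrt (f : T -> R) :
  measurable_fun setT f -> measurable_fun setT (fun x => Num.sqrt (f x)).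
Proof.
have ms : measurable_fun setT (Num.sqrt : R -> R).
  by apply: continuous_measurable_fun; exact: sqrt_continuous.
by move=> mf; exact: measurableT_comp ms mf.
Qed.

Lemma measurable_enorm n (f : T -> 'rV[R]_n) :
  measurable_fun setT f -> measurable_fun setT (fun x => enorm (f x)).
Proof. by move=> mf; apply: measurable_sqrt; exact: measurable_dotprod. Qed.

Lemma measurable_addmx m n (f g : T -> 'M[R]_(m, n)) :
  measurable_fun setT f -> measurable_fun setT g ->
  measurable_fun setT (fun x => f x + g x).
Proof.
move=> mf mg; apply: measurable_fun_mxP => i j; under eq_fun do rewrite mxE.
by apply: measurable_funD; exact: measurable_mxE.
Qed.

Lemma measurable_oppmx m n (f : T -> 'M[R]_(m, n)) :
  measurable_fun setT f -> measurable_fun setT (fun x => - f x).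
Proof.
move=> mf; apply: measurable_fun_mxP => i j; under eq_fun do rewrite mxE.
by apply: measurable_funN; exact: measurable_mxE.
Qed.

Lemma measurable_scalemx m n (a : T -> R) (f : T -> 'M[R]_(m, n)) :
  measurable_fun setT a -> measurable_fun setT f ->
  measurable_fun setT (fun x => a x *: f x).
Proof.
move=> ma mf; apply: measurable_fun_mxP => i j; under eq_fun do rewrite mxE.
by apply: measurable_funM => //; exact: measurable_mxE.
Qed.

Lemma measurable_mulmx m n p (f : T -> 'M[R]_(m, n)) (g : T -> 'M[R]_(n, p)) :
  measurable_fun setT f -> measurable_fun setT g ->
  measurable_fun setT (fun x => f x *m g x).
Proof.
move=> mf mg; apply: measurable_fun_mxP => i j; under eq_fun do rewrite mxE.
by apply: measurable_sum => l; apply: measurable_funM; exact: measurable_mxE.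
Qed.

Lemma measurable_det n (f : T -> 'M[R]_n) :
  measurable_fun setT f -> measurable_fun setT (fun x => \det (f x)).
Proof.
move=> mf; rewrite /determinant; apply: measurable_sum => s.
by apply: measurable_funM => //; apply: measurable_prod => i _; exact: measurable_mxE.
Qed.

Lemma measurable_adj n (f : T -> 'M[R]_n) :
  measurable_fun setT f -> measurable_fun setT (fun x => \adj (f x)).
Proof.
move=> mf; apply: measurable_fun_mxP => i j; under eq_fun do rewrite mxE.
rewrite /cofactor; apply: measurable_funM => //; apply: measurable_det.
apply: measurable_fun_mxP => a b; under eq_fun do rewrite !mxE.
exact: measurable_mxE.
Qed.

End measurable_algebra.

(** * Closest points of two flats *)

Section pairs_of_flats.
Context {R : realType} {d k : nat} {kd : (2 * k < d)%N}.
Implicit Types (L M : grassmannian R kd) (E F : flat R kd) (p : flat R kd * flat R kd).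

Definition pair_gap p : 'M[R]_d := flat_rej p.1 + flat_rej p.2.

(** In general position, the point minimizing the sum of the squared distances to
    both flats, with normal equation pair_mid_gap; it is the midpoint of the two
    closest points (midpointE). *)
Definition pair_mid p : 'rV[R]_d :=
  (\det (pair_gap p))^-1 *: ((foot p.1 + foot p.2) *m \adj (pair_gap p)).

(** The difference closest1 p - closest2 p, recovered from the midpoint. *)
Definition pair_diff p : 'rV[R]_d := 2 *: (foot p.1 - pair_mid p *m flat_rej p.1).

Definition gp_pairs : set (flat R kd * flat R kd) := [set p | \det (pair_gap p) != 0].

Definition near_pairs (K : set 'rV[R]_d) (delta : R) : set (flat R kd * flat R kd) :=
  gp_pairs `&` [set p | enorm (pair_diff p) <= delta] `&` pair_mid @^-1` K.

Lemma measurable_pair_gap : measurable_fun setT pair_gap.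
Proof.
apply: measurable_addmx; apply: measurableT_comp measurable_flat_rej _ => //.
Qed.

Lemma measurable_pair_mid : measurable_fun setT pair_mid.
Proof.
apply: measurable_scalemx.
  by apply: measurable_inv; apply: measurable_det; exact: measurable_pair_gap.
apply: measurable_mulmx; last by apply: measurable_adj; exact: measurable_pair_gap.
by apply: measurable_addmx; apply: measurableT_comp measurable_foot _.
Qed.

Lemma measurable_pair_diff : measurable_fun setT pair_diff.
Proof.
apply: measurable_scalemx => //; apply: measurable_addmx.
  exact: measurableT_comp measurable_foot _.
apply: measurable_oppmx; apply: measurable_mulmx measurable_pair_mid _.
exact: measurableT_comp measurable_flat_rej _.
Qed.

Lemma measurable_gp_pairs : measurable gp_pairs.
Proof.
rewrite (_ : gp_pairs = ~` ((fun p => \det (pair_gap p)) @^-1` [set 0])).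
  apply: measurableC; apply: measurable_preimage => //.
  by apply: measurable_det; exact: measurable_pair_gap.
by apply/seteqP; split => p /=; [move=> /eqP|move=> ?; apply/eqP].
Qed.

Lemma measurable_near_pairs K delta : compact K -> measurable (near_pairs K delta).
Proof.
move=> cK; apply: measurableI; first apply: measurableI.
- exact: measurable_gp_pairs.
- apply: measurable_le_cst; apply: measurable_enorm; exact: measurable_pair_diff.
- apply: measurable_preimage; first exact: measurable_pair_mid.
  exact: compact_measurable_rV.
Qed.

Lemma pair_mid_gap p : gp_pairs p -> pair_mid p *m pair_gap p = foot p.1 + foot p.2.
Proof.
move=> p0; rewrite -scalemxAl -mulmxA mul_adj_mx mul_mx_scalar scalerA.
by rewrite mulVf// scale1r.
Qed.

Lemma pair_mid_uniq p m : gp_pairs p -> m *m pair_gap p = foot p.1 + foot p.2 ->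
  pair_mid p = m.
Proof.
move=> p0; rewrite -(pair_mid_gap p0).
have u : pair_gap p \in unitmx by rewrite unitmxE unitfE.
by move=> /(congr1 (mulmx^~ (invmx (pair_gap p)))); rewrite !mulmxK.
Qed.

Lemma pair_diffE p : gp_pairs p ->
  pair_diff p = 2 *: (pair_mid p *m flat_rej p.2 - foot p.2).
Proof.
move=> /pair_mid_gap; rewrite mulmxDr => mE; congr (_ *: _).
have -> : pair_mid p *m flat_rej p.2 = foot p.1 + foot p.2 - pair_mid p *m flat_rej p.1.
  by rewrite -mE addrC addKr.
by rewrite addrAC addrK.
Qed.

Lemma pair_diff_rej1 p : pair_diff p *m flat_rej p.1 = pair_diff p.
Proof. by rewrite -scalemxAl mulmxBl foot_rej -mulmxA rej_idem. Qed.

Lemma pair_diff_rej2 p : gp_pairs p -> pair_diff p *m flat_rej p.2 = pair_diff p.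
Proof.
by move=> p0; rewrite pair_diffE// -scalemxAl mulmxBl foot_rej -mulmxA rej_idem.
Qed.

Definition closest1 p := pair_mid p + 2^-1 *: pair_diff p.
Definition closest2 p := pair_mid p - 2^-1 *: pair_diff p.

Lemma closest1_mem p : flat_points p.1 (closest1 p).
Proof.
apply/mem_flat; rewrite /closest1 mulmxDl -(scalemxAl 2^-1) pair_diff_rej1 /pair_diff scalerA.
by rewrite mulVf// scale1r addrC subrK.
Qed.

Lemma closest2_mem p : gp_pairs p -> flat_points p.2 (closest2 p).
Proof.
move=> p0; apply/mem_flat.
rewrite /closest2 mulmxBl -(scalemxAl 2^-1) pair_diff_rej2// pair_diffE//.
by rewrite scalerA mulVf// scale1r subKr.
Qed.

Lemma closest_sub p : closest1 p - closest2 p = pair_diff p.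
Proof.
rewrite /closest1 /closest2; move: (pair_mid p) (pair_diff p) => m w.
by apply/rowP => i; rewrite !mxE; field.
Qed.

(** Pythagoras' theorem: pair_diff p is orthogonal to both directions. *)
Lemma sqnorm_sub p x y : gp_pairs p -> flat_points p.1 x -> flat_points p.2 y ->
  dotprod (x - y) (x - y) = dotprod (pair_diff p) (pair_diff p)
    + dotprod ((x - closest1 p) - (y - closest2 p)) ((x - closest1 p) - (y - closest2 p)).
Proof.
move=> p0 /mem_flat xE /mem_flat yF.
set u := x - closest1 p; set v := y - closest2 p; set w := pair_diff p.
have -> : x - y = w + (u - v).
  rewrite /w -closest_sub /u /v; move: (closest1 p) (closest2 p) => a b.
  by apply/rowP => i; rewrite !mxE; ring.
have wu : dotprod w u = 0.
  rewrite /w -pair_diff_rej1 dotprod_rejC mulmxBl xE.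
  by have /mem_flat -> := closest1_mem p; rewrite subrr linear0.
have wv : dotprod w v = 0.
  rewrite /w -pair_diff_rej2// dotprod_rejC mulmxBl yF.
  by have /mem_flat -> := closest2_mem p0; rewrite subrr linear0.
have we : dotprod w (u - v) = 0 by rewrite dotprodBr wu wv subrr.
move: (u - v) we => e we.
by rewrite dotprodDl !dotprodDr (dotprodC e w) we addr0 add0r.
Qed.

Lemma flat_distE p : gp_pairs p -> flat_dist p.1 p.2 = enorm (pair_diff p).
Proof.
move=> p0; pose A := [set enorm (x - y) |
  x in flat_points p.1 & y in flat_points p.2].
have Ap : A (enorm (pair_diff p)).
  exists (closest1 p); first exact: closest1_mem.
  by exists (closest2 p); [exact: closest2_mem|rewrite closest_sub].
have lA : lbound A (enorm (pair_diff p)).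
  move=> _ [x xE [y yF <-]]; rewrite ler_wsqrtr// (sqnorm_sub p0 xE yF).
  by rewrite lerDl dotprod_ge0.
apply/eqP; rewrite eq_le; apply/andP; split.
  by apply: ge_inf => //; exists (enorm (pair_diff p)).
by apply: lb_le_inf => //; exists (enorm (pair_diff p)).
Qed.

(** By sqnorm_sub, another minimizing pair would arise by adding to both points
    a common vector of the two directions. *)
Lemma closest_pointsE p : gp_pairs p -> closest_points p.1 p.2 = (closest1 p, closest2 p).
Proof.
move=> p0; rewrite /closest_points; set S := [set q | _].
have S0 : S (closest1 p, closest2 p).
  by split => /=; [exact: closest1_mem|exact: closest2_mem|rewrite closest_sub flat_distE].
have [] : S (xget (0, 0) S) by exact: xgetI S0.
case: (xget _ _) => x y /= xE yF.
rewrite flat_distE// => /(congr1 (fun x => x ^+ 2)).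
rewrite !sqr_sqrtr ?dotprod_ge0// (sqnorm_sub p0 xE yF).
rewrite -[RHS]addr0 => /addrI/eqP; rewrite dotprod_eq0 subr_eq0 => /eqP uv.
have u0 : (x - closest1 p) *m pair_gap p = 0.
  rewrite mulmxDr {2}uv (mulmxBl x) (mulmxBl y).
  have /mem_flat -> := xE; have /mem_flat -> := yF.
  have /mem_flat -> := closest1_mem p; have /mem_flat -> := closest2_mem p0.
  by rewrite !subrr addr0.
have u : pair_gap p \in unitmx by rewrite unitmxE unitfE.
have {}u0 : x - closest1 p = 0 by rewrite -[LHS](mulmxK u) u0 mul0mx.
by congr pair; apply/eqP; rewrite -subr_eq0 -?uv u0.
Qed.

Lemma midpointE p : gp_pairs p -> midpoint p.1 p.2 = pair_mid p.
Proof.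
move=> p0; rewrite /midpoint closest_pointsE//= /closest1 /closest2 addrACA subrr addr0.
by move: (pair_mid p) => m; apply/rowP => i; rewrite !mxE; field.
Qed.

Lemma near_pairsE K delta p : gp_pairs p ->
  near_pairs K delta p <-> (flat_dist p.1 p.2 <= delta /\ K (midpoint p.1 p.2)).
Proof.
move=> p0; rewrite flat_distE// midpointE//; split; first by move=> [[_ ? ?]].
by move=> [? ?]; split.
Qed.

End pairs_of_flats.

(** * Pairs of flats with two given directions *)

Section integral_geometry.
Variables (R : realType).
Local Notation leb n := (lebesgue_rV R n).

Lemma indic_preimage (S T : Type) (h : S -> T) (A : set T) x :
  \1_(h @^-1` A) x = \1_A (h x) :> R.
Proof.
rewrite !indicE; have -> // : (x \in h @^-1` A) = (h x \in A).
by apply/idP/idP => /set_mem ?; exact: mem_set.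
Qed.

Lemma measurable_lsubmx m n : measurable_fun setT (fun z : 'rV[R]_(m + n) => lsubmx z).
Proof.
apply: measurable_fun_mxP => i j; under eq_fun do rewrite mxE; exact: measurable_entry.
Qed.

Lemma measurable_rsubmx m n : measurable_fun setT (fun z : 'rV[R]_(m + n) => rsubmx z).
Proof.
apply: measurable_fun_mxP => i j; under eq_fun do rewrite mxE; exact: measurable_entry.
Qed.

Lemma integral_rV_add_indic m n (A : set 'rV[R]_(m + n)) : measurable A ->
  (\int[leb m]_u \int[leb n]_v (\1_A (row_mx u v))%:E = leb (m + n) A)%E.
Proof.
move=> mA; rewrite -[RHS]/((leb (m + n)) A) -[in RHS](setIT A) -integral_indic//.
apply/esym; apply: (@integral_rV_add R m n (EFin \o \1_A)).
  by apply/measurable_EFinP; exact: measurable_indic.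
by move=> v; rewrite lee_fin.
Qed.

Lemma lebesgue_rV_prod m n (A : set 'rV[R]_m) (B : set 'rV[R]_n) :
  measurable A -> measurable B ->
  leb (m + n) [set z | A (lsubmx z) /\ B (rsubmx z)] = (leb m A * leb n B)%E.
Proof.
move=> mA mB; rewrite -integral_rV_add_indic; last first.
  apply: (measurableI (lsubmx @^-1` A) (rsubmx @^-1` B)).
  - exact: measurable_preimage (@measurable_lsubmx m n) mA.
  - exact: measurable_preimage (@measurable_rsubmx m n) mB.
transitivity (\int[leb m]_u (leb n B * (\1_A u)%:E))%E.
  apply: eq_integral => u _.
  transitivity (\int[leb n]_v ((\1_A u)%:E * (\1_B v)%:E))%E.
    apply: eq_integral => v _; rewrite -EFinM !indicE -natrM mulnb; congr (_%:R%:E).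
    congr nat_of_bool; apply/idP/andP.
      by move=> /set_mem[/=]; rewrite row_mxKl row_mxKr => *; split; exact: mem_set.
    move=> [/set_mem Au /set_mem Bv]; apply: mem_set => /=.
    by rewrite row_mxKl row_mxKr.
  rewrite ge0_integralZl_EFin//; last first.
    by apply/measurable_EFinP; exact: measurable_indic.
  by rewrite integral_indic// setIT muleC.
rewrite ge0_integralZl//; last first.
  by apply/measurable_EFinP; exact: measurable_indic.
by rewrite integral_indic// setIT muleC.
Qed.

Lemma integral_lebesgue_on n (W : {vspace 'rV[R]_n}) (f : 'rV[R]_n -> \bar R) :
  measurable_fun setT f -> (forall v, 0 <= f v)%E ->
  (\int[lebesgue_on W]_x f x = \int[leb (\dim W)]_y f (y *m onb W))%E.
Proof.
move=> mf f0; rewrite [LHS](@ge0_integral_pushforward _ _ 'rV[R]_(\dim W) _ _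
  (fun y => y *m onb W) (measurable_mulmxr _) (leb (\dim W)) setT)//.
Qed.

End integral_geometry.

Section kinematic.
Context {R : realType} {d k : nat} {kd : (2 * k < d)%N}.
Local Notation leb n := (lebesgue_rV R n).
Variables (M L : grassmannian R kd) (K : set 'rV[R]_d) (delta : R).
Hypothesis ML : general_position M L.
Hypothesis cK : compact K.
Hypothesis delta0 : 0 <= delta.

Let W : {vspace 'rV[R]_d} := orthocomp (M + L)%VS.
Let BW := onb W.
Let BM := onb (orthocomp M).
Let BL := onb (orthocomp L).

(** The linear map taking the midpoint m and the coordinates s of the difference
    vector w = s *m BW to the coordinates of the flats L + (m - w / 2) in L^perp and
    M + (m + w / 2) in M^perp. *)
Definition kin_mx : 'M[R]_(d + \dim W, \dim (orthocomp L) + \dim (orthocomp M)) :=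
  block_mx BL^T BM^T (- 2^-1 *: (BW *m BL^T)) (2^-1 *: (BW *m BM^T)).

Lemma dim_grassmannian (N : grassmannian R kd) : \dim N = k.
Proof. by case: N => N /= /eqP. Qed.

Lemma dim_common : \dim W = (d - 2 * k)%N.
Proof.
have := dim_orthocomp (M + L)%VS; move/dim_sum_gp : ML => /eqP ->.
by rewrite !dim_grassmannian -/W addnn -mul2n => /(congr1 (subn^~ (2 * k)%N)); rewrite addnK.
Qed.

Lemma dim_kin : (d + \dim W = \dim (orthocomp L) + \dim (orthocomp M))%N.
Proof.
have := dim_orthocomp L; have := dim_orthocomp M; rewrite !dim_grassmannian dim_common.
have := kd; lia.
Qed.

Lemma common_rej (N : {vspace 'rV[R]_d}) : (N <= M + L)%VS -> BW *m rej N = BW.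
Proof.
move=> NML; apply/row_matrixP => i; rewrite row_mul /rej mulmxBr mulmx1.
rewrite (_ : row i BW *m oproj N = 0) ?subr0//; apply/eqP; rewrite -mem_orthocomp_proj.
apply/mem_orthocomp => w wN.
have [_ /(_ i) /mem_orthocomp] := onbP W; apply; exact: (subvP NML).
Qed.

Lemma common_rejM : BW *m rej M = BW. Proof. by rewrite common_rej// addvSl. Qed.
Lemma common_rejL : BW *m rej L = BW. Proof. by rewrite common_rej// addvSr. Qed.

(** The mixed blocks cancel because the rows of BW are orthogonal to M and to L and
    occur with opposite signs. *)
Lemma kin_mx_gram : kin_mx *m kin_mx^T =
  block_mx (gap M L) 0 0 (2^-1%:M).
Proof.
rewrite /kin_mx tr_block_mx mulmx_block !trmxK !linearZ/= !trmx_mul !trmxK.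
have BMM : BM^T *m BM = rej M by rewrite -/(oproj _) proj_orthocomp.
have BLL : BL^T *m BL = rej L by rewrite -/(oproj _) proj_orthocomp.
rewrite -!scalemxAl !scalerA.
rewrite !(mulmxA _ BL) !(mulmxA _ BM) -!(mulmxA BW) BLL BMM.
congr block_mx.
- by rewrite /gap addrC.
- have E N : BW *m rej N = BW -> rej N *m BW^T = BW^T.
    by move=> BN; rewrite -{2}BN trmx_mul tr_rej.
  by rewrite !E ?common_rejM ?common_rejL// scaleNr addNr.
- by rewrite common_rejM common_rejL scaleNr addNr.
- rewrite !(mulmxA BW) common_rejM common_rejL onbK.
  rewrite -scalerDl scale_scalar_mx mulr1; congr (_%:M).
  by field.
Qed.

Lemma kin_mx_det : \det (kin_mx *m kin_mx^T) != 0 /\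
  (Num.sqrt (\det (kin_mx *m kin_mx^T)))%:E = subspace_det M L.
Proof.
have W2 : 2^-1 ^+ \dim W = 2 ^+ (\dim M + \dim L) / 2 ^+ d :> R.
  have /dim_sum_gp/eqP <- := ML.
  have -> : 2 ^+ d = 2 ^+ \dim W * 2 ^+ \dim (M + L)%VS :> R.
    by rewrite -exprD; congr (_ ^+ _); exact/esym/dim_orthocomp.
  by rewrite invfM exprVn mulrCA divff ?mulr1// expf_neq0.
rewrite kin_mx_gram det_ublock det_scalar W2 mulrC -subspace_detE; split => //.
rewrite !mulf_neq0 ?invr_neq0 ?expf_neq0//.
by move/gap_unit : ML; rewrite unitmxE unitfE.
Qed.

(** Only the component of x orthogonal to N matters. *)
Lemma translate_onb (N : grassmannian R kd) (x : 'rV[R]_d) :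
  translate N (x *m (onb (orthocomp N))^T *m onb (orthocomp N)) = translate N x.
Proof.
apply: flat_rej_foot_inj; rewrite ?flat_rej_translate// !foot_translate.
by rewrite -[x *m _ *m _]mulmxA -/(oproj _) proj_orthocomp -mulmxA rej_idem.
Qed.

Lemma near_pairs_kin (m : 'rV[R]_d) (s : 'rV[R]_(\dim W)) :
  near_pairs K delta (translate M (m + 2^-1 *: (s *m BW)), translate L (m - 2^-1 *: (s *m BW)))
  <-> K m /\ enorm s <= delta.
Proof.
set p := (_, _).
have rM : flat_rej p.1 = rej M by exact: flat_rej_translate.
have rL : flat_rej p.2 = rej L by exact: flat_rej_translate.
have p0 : gp_pairs p.
  by rewrite /gp_pairs/= /pair_gap rM rL; move/gap_unit : ML; rewrite unitmxE unitfE.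
have sM : s *m BW *m rej M = s *m BW by rewrite -mulmxA common_rejM.
have sL : s *m BW *m rej L = s *m BW by rewrite -mulmxA common_rejL.
have fM : foot p.1 = m *m rej M + 2^-1 *: (s *m BW).
  by rewrite foot_translate mulmxDl -scalemxAl sM.
have fL : foot p.2 = m *m rej L - 2^-1 *: (s *m BW).
  by rewrite foot_translate mulmxBl -scalemxAl sL.
have mE : pair_mid p = m.
  apply: pair_mid_uniq => //; rewrite /pair_gap rM rL fM fL mulmxDr.
  by rewrite addrACA subrr addr0.
have dE : enorm (pair_diff p) = enorm s.
  rewrite /pair_diff mE rM fM addrAC subrr add0r scalerA divff// scale1r.
  by rewrite /enorm /dotprod trmx_mul mulmxA -(mulmxA s) onbK mulmx1.
rewrite /near_pairs/= mE dE; split; first by move=> [[]].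
by move=> [].
Qed.

Lemma kinematic :
  (\int[lebesgue_on (orthocomp L)]_y \int[lebesgue_on (orthocomp M)]_x
     (\1_(near_pairs K delta) (translate M x, translate L y))%:E =
   unit_ball_volume (d - 2 * k) * (delta ^+ (d - 2 * k))%:E * leb d K * subspace_det M L)%E.
Proof.
pose A := @near_pairs R d k kd K delta.
have mA : measurable A by exact: measurable_near_pairs.
have m1A : measurable_fun setT (\1_A : flat R kd * flat R kd -> R) by exact: measurable_indic.
pose h (z : 'rV[R]_(\dim (orthocomp L) + \dim (orthocomp M))) :=
  (translate M (rsubmx z *m BM), translate L (lsubmx z *m BL)).
have hE u v : h (row_mx u v) = (translate M (v *m BM), translate L (u *m BL)).
  by rewrite /h row_mxKl row_mxKr.
have mS : measurable (h @^-1` A).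
  apply: measurable_preimage => //; apply: measurable_fun_pair.
  - apply: (measurableT_comp (measurable_translate M)).
    exact: measurableT_comp (measurable_mulmxr _) (@measurable_rsubmx _ _ _).
  - apply: (measurableT_comp (measurable_translate L)).
    exact: measurableT_comp (measurable_mulmxr _) (@measurable_lsubmx _ _ _).
transitivity (\int[leb (\dim (orthocomp L))]_u \int[leb (\dim (orthocomp M))]_v
    (\1_(h @^-1` A) (row_mx u v))%:E)%E.
  pose g y v : \bar R := (\1_A (translate M (v *m BM), translate L y))%:E.
  have mg : measurable_fun setT (fun q => g q.1 q.2).
    apply/measurable_EFinP; apply: (measurableT_comp m1A).
    apply: measurable_fun_pair.
    - apply: (measurableT_comp (measurable_translate M)).
      exact: measurableT_comp (measurable_mulmxr _) measurable_snd.
    - exact: (measurableT_comp (measurable_translate L)) measurable_fst.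
  transitivity (\int[lebesgue_on (orthocomp L)]_y
      \int[leb (\dim (orthocomp M))]_v g y v)%E.
    apply: eq_integral => y _; apply: integral_lebesgue_on => //.
    apply/measurable_EFinP; apply: (measurableT_comp m1A).
    by apply: measurable_fun_pair => //; exact: measurable_translate.
  rewrite integral_lebesgue_on.
  - apply: eq_integral => u _; apply: eq_integral => v _.
    transitivity ((\1_A (h (row_mx u v)))%:E : \bar R); first by rewrite hE.
    by rewrite indic_preimage.
  - apply: (measurable_fun_fubini_tonelli_F (fun q => g q.1 q.2) mg) => q.
    by rewrite lee_fin indicE.
  - by move=> y; apply: integral_ge0 => v _; rewrite lee_fin indicE.
rewrite integral_rV_add_indic//.
have [d0 dE] := kin_mx_det.
rewrite (lebesgue_mulmx dim_kin d0 mS) dE [LHS]muleC; congr (_ * _)%E.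
have -> : [set v | (h @^-1` A) (v *m kin_mx)] =
    [set z | K (lsubmx z) /\ enorm (rsubmx z) <= delta].
  have key m s : h (row_mx m s *m kin_mx) =
      (translate M (m + 2^-1 *: (s *m BW)), translate L (m - 2^-1 *: (s *m BW))).
    rewrite /kin_mx mul_row_block -!scalemxAr !mulmxA !scaleNr hE.
    congr pair; rewrite -[RHS]translate_onb; congr translate; congr (_ *m _).
      by rewrite mulmxDl -scalemxAl.
    by rewrite mulmxBl -scalemxAl.
  apply/seteqP; split => z /=; have := key (lsubmx z) (rsubmx z);
    rewrite hsubmxK => ->; first by move/near_pairs_kin.
  by move=> zK; apply/near_pairs_kin.
rewrite (@lebesgue_rV_prod R d (\dim W) K [set s | enorm s <= delta]); last 2 first.
- exact: compact_measurable_rV.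
- exact: measurable_eball.
rewrite muleC lebesgue_eball//; last by rewrite dim_common subn_gt0.
by rewrite dim_common; congr (_ * _)%E; exact: muleC.
Qed.

End kinematic.

(** * Counting pairs of points *)

Section pair_counts.
Context {R : realType} {T : choiceType}.
Local Open Scope ereal_scope.
Implicit Types (e A B : set T) (C : set (T * T)).

Lemma esum_cst_fin (S : choiceType) (X : set S) (r : R) : finite_set X -> (0 <= r)%R ->
  \esum_(x in X) r%:E = r%:E * counting X.
Proof.
move=> fX r0; rewrite esum_fset ?lee_fin// fsbig_finite//= /counting asboolT//.
by rewrite sumEFin big_const_seq count_predT iter_addr_0 -EFinM mulr_natr.
Qed.

Lemma counting_ltyP (S : choiceType) (X : set S) : counting X < +oo :> \bar R <-> finite_set X.
Proof.
rewrite /counting; split; last by move=> fX; rewrite asboolT// ltry.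
by case: ifPn => [/asboolP//|]; rewrite ltxx.
Qed.

Lemma counting_natP (S : choiceType) (X : set S) : finite_set X ->
  exists n : nat, counting X = n%:R%:E :> \bar R.
Proof. by move=> fX; rewrite /counting asboolT//; eexists; reflexivity. Qed.

Definition distinct e : set (T * T) := [set p | [/\ e p.1, e p.2 & p.1 <> p.2]].

Definition pair_count e C : \bar R := \esum_(p in distinct e `&` C) 1.

Lemma pair_count_ge0 e C : 0 <= pair_count e C.
Proof. by apply: esum_ge0. Qed.

Lemma pair_count_bigcup e (F : (set (T * T))^nat) : trivIset setT F ->
  pair_count e (\bigcup_n F n) = \sum_(n <oo) pair_count e (F n).
Proof.
move=> tF; rewrite /pair_count setI_bigcupr nneseries_sum_bigcup//.
by apply: trivIset_setIl.
Qed.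

Lemma pair_count_ID e C C' :
  pair_count e C' = pair_count e (C `&` C') + pair_count e (~` C `&` C').
Proof.
rewrite /pair_count (esumID C)//.
by rewrite -!setIA (setIC C') (setIC C').
Qed.

Lemma pair_count_rect e A B : A `&` B = set0 ->
  finite_set (e `&` A) -> finite_set (e `&` B) ->
  pair_count e (A `*` B) = counting (e `&` A) * counting (e `&` B).
Proof.
move=> AB fA fB; rewrite /pair_count.
have -> : distinct e `&` A `*` B = (e `&` A) `*`` (fun=> e `&` B).
  apply/seteqP; split => -[x y] /=; first by move=> [[? ? ?] [? ?]].
  move=> [[ex Ax] [ey By]]; split; split => //= xy; rewrite -xy in By.
  by have : (A `&` B) x by []; rewrite AB.
rewrite -(@esum_esum _ _ _ _ _ (fun _ _ => 1))//.
have [m mB] := counting_natP fB.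
under eq_esum do rewrite esum_cst_fin// mul1e mB.
by rewrite esum_cst_fin// mB muleC.
Qed.

End pair_counts.

Section series.
Context {R : realType}.
Local Open Scope ereal_scope.

Lemma eseries_single (f : nat -> \bar R) n : (forall k, 0 <= f k) ->
  (forall k, k != n -> f k = 0) -> \sum_(k <oo) f k = f n.
Proof.
move=> f0 fn; rewrite (@nneseriesD1 _ f n xpredT)// eseries0 ?adde0//.
by move=> k _ /andP[_ kn]; exact: fn.
Qed.

(** At rate 0 poisson_pmf is identically 1, whereas the Poisson distribution is the
    Dirac measure at 0. *)
Definition poisson_weight (r : R) (n : nat) : R :=
  if (0 < r)%R then poisson_pmf r n else (n == 0%N)%:R.

Lemma poisson_weight_ge0 r n : (0 <= poisson_weight r n)%R.
Proof. by rewrite /poisson_weight; case: ifP => // _; exact: poisson_pmf_ge0. Qed.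

Lemma poisson_prob_set1 r k n : poisson_prob r k [set n] = (poisson_weight r n)%:E.
Proof.
rewrite /poisson_prob /poisson_weight; case: ifPn => r0.
  by rewrite esum_set1// lee_fin poisson_pmf_ge0.
rewrite diracE; congr (_%:R%:E); congr nat_of_bool.
by apply/idP/eqP => [/set_mem//|->]; exact: mem_set.
Qed.

Lemma poisson_weight_sum r : \sum_(n <oo) (poisson_weight r n)%:E = 1.
Proof.
have := probability_setT (poisson_prob r 0%N).
rewrite [setT in X in X -> _](_ : _ = \bigcup_n [set n]); last first.
  by apply/seteqP; split => n // _; exists n.
move=> <-.
rewrite measure_bigcup//; last by move=> i j _ _ [x [/= -> ->]].
rewrite [RHS](eq_eseriesl (Q := xpredT)); last by move=> n; rewrite in_setT.
by apply: eq_eseriesr => n _; exact/esym/(poisson_prob_set1 r 0%N).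
Qed.

Lemma poisson_weight_mean r : (0 <= r)%R ->
  \sum_(n <oo) (n%:R * poisson_weight r n)%:E = r%:E.
Proof.
move=> r0; have t0 n : 0 <= (n%:R * poisson_weight r n)%:E.
  by rewrite lee_fin mulr_ge0// poisson_weight_ge0.
move: r0; rewrite le_eqVlt => /predU1P[r0|r0].
  rewrite -r0 eseries0// => n _ _; rewrite /poisson_weight ltxx.
  by case: n => [|n]; rewrite ?mul0r ?mulr0.
rewrite nneseries_recl// mul0r add0e -nneseries_addn//.
rewrite -[RHS]mule1 -(poisson_weight_sum r) -nneseriesZl; last first.
  by move=> n _; rewrite lee_fin poisson_weight_ge0.
apply: eq_eseriesr => n _; rewrite -EFinM /poisson_weight r0 /poisson_pmf r0; congr EFin.
rewrite addn1 exprS factS natrM invfM.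
by field; rewrite nat1r !pnatr_eq0 -lt0n fact_gt0.
Qed.

End series.

(** * Moments of the counts of a Poisson process *)

Section poisson_pairs.
Context {R : realType} {d d' : measure_display} {Omega : measurableType d}
  {T : measurableType d'}.
Variables (P : probability Omega R) (theta : {sigma_finite_measure set T -> \bar R}).
Variable eta : Omega -> set T.
Hypothesis heta : poisson_process P theta eta.
Local Open Scope ereal_scope.

Local Notation N A := (fun w => counting (eta w `&` A) : \bar R).

Definition count_event A (n : nat) : set Omega := [set w | N A w = n%:R%:E].

Lemma measurable_count_event A n : measurable A -> measurable (count_event A n).
Proof.
move=> mA; rewrite (_ : count_event A n = N A @^-1` [set n%:R%:E])//.
by apply: measurable_preimage => //; exact: (poisson_measurable heta).
Qed.

Lemma prob_count_event A n : measurable A -> theta A < +oo ->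
  P (count_event A n) = (poisson_weight (fine (theta A)) n)%:E.
Proof.
by move=> mA Aoo; rewrite (poisson_finite heta)// poisson_prob_set1.
Qed.

Definition fin_event A : set Omega := [set w | N A w < +oo].

Lemma measurable_fin_event A : measurable A -> measurable (fin_event A).
Proof.
move=> mA; rewrite -[fin_event A]setTI; apply: emeasurable_fun_infty_o => //.
exact: (poisson_measurable heta).
Qed.

Lemma fin_event_set A w : fin_event A w <-> finite_set (eta w `&` A).
Proof. exact: counting_ltyP. Qed.

Lemma trivIset_count_event A : trivIset setT (count_event A).
Proof.
move=> i j _ _ [w []]; rewrite /count_event/= => -> [] /eqP; rewrite eqr_nat.
by move/eqP.
Qed.

(** The Poisson weights sum to 1, which leaves no mass for the value +oo. *)
Lemma prob_fin_event A : measurable A -> theta A < +oo -> P (~` fin_event A) = 0.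
Proof.
move=> mA Aoo; rewrite probability_setC; last exact: measurable_fin_event.
rewrite (_ : fin_event A = \bigcup_n count_event A n); last first.
  apply/seteqP; split => w /=.
    by move=> /fin_event_set/(@counting_natP R)[n En]; exists n.
  by move=> [n _]; rewrite /count_event /fin_event/= => ->; rewrite ltry.
rewrite measure_bigcup//; last 2 first.
- by move=> n _; exact: measurable_count_event.
- exact: trivIset_count_event.
rewrite (eq_eseriesl (Q := xpredT)); last by move=> n; rewrite in_setT.
rewrite (eq_eseriesr (fun n _ => prob_count_event n mA Aoo)) poisson_weight_sum.
by rewrite subee.
Qed.

Lemma prob_setI_null (G X : set Omega) : measurable G -> measurable X ->
  P (~` G) = 0 -> P (G `&` X) = P X.
Proof.
move=> mG mX G0; rewrite [RHS](measureDI _ mX mG) setIC [X in _ = X + _](_ : _ = 0) ?add0e//.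
apply: (subset_measure0 _ _ _ G0).
- exact: measurableD.
- exact: measurableC.
- by move=> w [].
Qed.

Lemma prob_count_event2 A B i j : measurable A -> measurable B -> A `&` B = set0 ->
  P (count_event A i `&` count_event B j) = P (count_event A i) * P (count_event B j).
Proof.
move=> mA mB AB.
pose S (a : 'I_2) := if val a == 0%N then A else B.
(* Two-element families, to which mutual independence applies. *)
pose C (a : 'I_2) : set (\bar R) := if val a == 0%N then [set i%:R%:E] else [set j%:R%:E].
have mS a : measurable (S a) by rewrite /S; case: ifP.
have tS : trivIset setT S.
  move=> a b _ _ [x []]; rewrite /S; case: ifPn => a0; case: ifPn => b0 xa xb.
  - by apply/val_inj; rewrite (eqP a0) (eqP b0).
  - by have : (A `&` B) x by []; rewrite AB.
  - by have : (A `&` B) x by []; rewrite AB.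
  - by apply/val_inj; move: a b a0 b0 {xa xb} => [[|[|]]// ?] [[|[|]]// ?].
have mC a : measurable (C a) by rewrite /C; case: ifP.
have := poisson_independent heta mS tS mC.
rewrite big_ord_recl big_ord1/= => <-; congr (P _).
apply/seteqP; split => w /=.
  by move=> [wA wB] a _; rewrite /C /S/=; case: ifP.
move=> wS; split.
  by have := wS ord0 Logic.I.
by have := wS (lift ord0 ord0) Logic.I.
Qed.

(** On G both counts are natural numbers, so that their product is a double series
    over the possible values, integrated term by term with prob_count_event2. *)
Lemma expectation_rect A B G : measurable A -> measurable B -> A `&` B = set0 ->
  theta A < +oo -> theta B < +oo -> measurable G -> P (~` G) = 0 ->
  (forall w, G w -> finite_set (eta w `&` A) /\ finite_set (eta w `&` B)) ->
  measurable_fun setT (fun w => (\1_G w)%:E * (N A w * N B w)) /\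
  \int[P]_w ((\1_G w)%:E * (N A w * N B w)) = theta A * theta B.
Proof.
move=> mA mB AB Aoo Boo mG G0 Gfin.
pose E i j := G `&` (count_event A i `&` count_event B j).
have mE i j : measurable (E i j).
  by apply: measurableI => //; apply: measurableI; exact: measurable_count_event.
pose g i j w : \bar R := (i%:R * j%:R)%:E * (\1_(E i j) w)%:E.
have g0 i j w : 0 <= g i j w by rewrite mule_ge0// lee_fin.
have mg i j : measurable_fun setT (g i j).
  apply: emeasurable_funM => //; apply/measurable_EFinP; exact: measurable_indic.
have gE w : (\1_G w)%:E * (N A w * N B w) = \sum_(i <oo) \sum_(j <oo) g i j w.
  have [Gw|nGw] := pselect (G w); last first.
    rewrite indicE memNset// mul0e eseries0// => i _ _; rewrite eseries0// => j _ _.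
    by rewrite /g indicE memNset ?mule0// => -[].
  have [fA fB] := Gfin w Gw.
  have [i Ai] := @counting_natP R _ _ fA; have [j Bj] := @counting_natP R _ _ fB.
  rewrite (@eseries_single _ _ i); last 2 first.
  - by move=> i'; apply: nneseries_ge0.
  - move=> i' ii'; rewrite eseries0// => j' _ _; rewrite /g indicE memNset ?mule0//.
    move=> [_ [+ _]]; rewrite /count_event/= Ai => -[] /eqP; rewrite eqr_nat => /eqP ii.
    by rewrite ii eqxx in ii'.
  rewrite (@eseries_single _ _ j)//; last first.
    move=> j' jj'; rewrite /g indicE memNset ?mule0//.
    move=> [_ [_ +]]; rewrite /count_event/= Bj => -[] /eqP; rewrite eqr_nat => /eqP jj.
    by rewrite jj eqxx in jj'.
  by rewrite /g Ai Bj !indicE !mem_set// mul1e mule1 -EFinM.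
split.
  apply: (eq_measurable_fun (fun w => \sum_(i <oo) \sum_(j <oo) g i j w)).
    by move=> w _; rewrite gE.
  apply: ge0_emeasurable_sum => [i w _ _|i _]; first exact: nneseries_ge0.
  by apply: ge0_emeasurable_sum.
under eq_integral do rewrite gE.
rewrite integral_nneseries//; last 2 first.
- by move=> i; exact: ge0_emeasurable_sum.
- by move=> i w _; exact: nneseries_ge0.
have tE S : measurable S -> theta S < +oo ->
    theta S = \sum_(n <oo) (n%:R * poisson_weight (fine (theta S)) n)%:E.
  move=> mS Soo; rewrite poisson_weight_mean ?fine_ge0// fineK// ge0_fin_numE//.
pose a := poisson_weight (fine (theta A)); pose b := poisson_weight (fine (theta B)).
transitivity (\sum_(i <oo) ((i%:R * a i)%:E * theta B)).
  apply: eq_eseriesr => i _; rewrite integral_nneseries//.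
  rewrite (tE B)// -nneseriesZl; last first.
    by move=> j _; rewrite lee_fin mulr_ge0// poisson_weight_ge0.
  apply: eq_eseriesr => j _; rewrite /g ge0_integralZl_EFin//; last first.
    by apply/measurable_EFinP; exact: measurable_indic.
  rewrite integral_indic// setIT.
  transitivity ((i%:R * j%:R)%:E * P (count_event A i `&` count_event B j)).
    congr (_ * _); apply: prob_setI_null => //.
    by apply: measurableI; exact: measurable_count_event.
  rewrite prob_count_event2// !prob_count_event// -!EFinM; congr EFin.
  by rewrite /a /b; ring.
rewrite [in RHS](tE A)// -[theta B]fineK ?ge0_fin_numE// muleC -nneseriesZl; last first.
  by move=> j _; rewrite lee_fin mulr_ge0// poisson_weight_ge0.
by apply: eq_eseriesr => i _; rewrite muleC.
Qed.

End poisson_pairs.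

(** * Campbell's formula for pairs of distinct points *)

Section campbell.
Context {R : realType} {d d' : measure_display} {Omega : measurableType d}
  {T : measurableType d'}.
Variables (P : probability Omega R) (theta : {sigma_finite_measure set T -> \bar R}).
Variable eta : Omega -> set T.
Hypothesis heta : poisson_process P theta eta.
Local Open Scope ereal_scope.

Let theta2 : {measure set (T * T) -> \bar R} := theta \x theta.

Section rectangle.
Variables (U V : set T) (G : set Omega).
Hypotheses (mU : measurable U) (mV : measurable V) (UV : U `&` V = set0).
Hypotheses (Uoo : theta U < +oo) (Voo : theta V < +oo).
Hypotheses (mG : measurable G) (G0 : P (~` G) = 0).
Hypothesis Gfin : forall w, G w -> finite_set (eta w `&` U) /\ finite_set (eta w `&` V).

Let h (C : set (T * T)) w : \bar R := (\1_G w)%:E * pair_count (eta w) (C `&` U `*` V).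

(** The Dynkin class of the proof. The event G, on which the counts in U and V are
    finite, makes it possible to subtract counts in the step for complements. *)
Definition campbell_class (C : set (T * T)) := measurable C /\
  (measurable_fun setT (h C) /\ \int[P]_w h C w = theta2 (C `&` U `*` V)).

Let h_ge0 C w : 0 <= h C w.
Proof. by rewrite mule_ge0// ?lee_fin ?indicE// pair_count_ge0. Qed.

Lemma campbell_class_rect A B : measurable A -> measurable B ->
  campbell_class (A `*` B).
Proof.
move=> mA mB; split; first exact: measurableX.
have XI : (A `*` B) `&` (U `*` V) = (A `&` U) `*` (B `&` V).
  by apply/seteqP; split => -[x y] /=; tauto.
have mAU := measurableI _ _ mA mU; have mBV := measurableI _ _ mB mV.
have AB : (A `&` U) `&` (B `&` V) = set0.
  by apply/seteqP; split => // x [[_ Ux] [_ Vx]]; rewrite -UV.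
have leU : theta (A `&` U) < +oo.
  exact: le_lt_trans (le_measureS theta mAU mU (@subIsetr _ _ _)) Uoo.
have leV : theta (B `&` V) < +oo.
  exact: le_lt_trans (le_measureS theta mBV mV (@subIsetr _ _ _)) Voo.
have fin w : G w -> finite_set (eta w `&` (A `&` U)) /\ finite_set (eta w `&` (B `&` V)).
  move=> /Gfin[fU fV]; split; [apply: sub_finite_set fU|apply: sub_finite_set fV];
    by move=> x [? []].
have [mN EN] := expectation_rect heta mAU mBV AB leU leV mG G0 fin.
have hE w : h (A `*` B) w = (\1_G w)%:E *
    (counting (eta w `&` (A `&` U)) * counting (eta w `&` (B `&` V))).
  rewrite /h XI; have [Gw|nGw] := pselect (G w); last by rewrite indicE memNset// !mul0e.
  by have [fU fV] := fin w Gw; rewrite pair_count_rect.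
split; first by apply: eq_measurable_fun mN => w _; rewrite hE.
by under eq_integral do rewrite hE; rewrite EN XI [RHS]product_measure1E.
Qed.

Let mUV : measurable (U `*` V). Proof. exact: measurableX. Qed.

Lemma theta2_rect_fin C : measurable C -> theta2 (C `&` U `*` V) < +oo.
Proof.
move=> mC; apply: (@le_lt_trans _ _ (theta2 (U `*` V))).
  exact: le_measureS (measurableI _ _ mC mUV) mUV (@subIsetr _ _ _).
by rewrite [ltLHS]product_measure1E// lte_mul_pinfty// ge0_fin_numE.
Qed.

Lemma campbell_classT : campbell_class setT.
Proof. by rewrite -setXTT; exact: campbell_class_rect. Qed.

Lemma campbell_classC C : measurable C -> campbell_class C -> campbell_class (~` C).
Proof.
move=> mC [_ [mhC EhC]]; have mC' := measurableC mC; split => //.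
have [_ [mhT EhT]] := campbell_classT.
have hT w : h setT w = h C w + h (~` C) w.
  by rewrite /h setTI (pair_count_ID _ C) ge0_muleDr// pair_count_ge0.
have hTfin w : h setT w < +oo.
  rewrite /h setTI; have [Gw|nGw] := pselect (G w); last by rewrite indicE memNset// mul0e ltry.
  have [fU fV] := Gfin Gw; rewrite pair_count_rect//.
  have [m ->] := @counting_natP R _ _ fU; have [n ->] := @counting_natP R _ _ fV.
  by rewrite -!EFinM ltry.
have hCfin w : h C w \is a fin_num.
  by rewrite ge0_fin_numE//; apply: le_lt_trans (hTfin w); rewrite hT leeDl.
have hE w : h (~` C) w = h setT w - h C w by rewrite hT (addeC (h C w)) addeK.
have mh : measurable_fun setT (h (~` C)).
  apply: (eq_measurable_fun (fun w => h setT w - h C w)); first by move=> w _; rewrite hE.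
  exact: emeasurable_funB.
split => //.
have : \int[P]_w h setT w = \int[P]_w h C w + \int[P]_w h (~` C) w.
  by rewrite -ge0_integralD//; apply: eq_integral => w _; rewrite hT.
have -> : \int[P]_w h setT w = theta2 (C `&` U `*` V) + theta2 (~` C `&` U `*` V).
  rewrite EhT setTI -measureU.
  - by rewrite -setIUl setUCr setTI.
  - exact: measurableI.
  - exact: measurableI.
  - by apply/seteqP; split => // p [[Cp _] [/(_ Cp)]].
have fC : theta2 (C `&` U `*` V) \is a fin_num.
  by rewrite ge0_fin_numE//; exact: theta2_rect_fin.
rewrite EhC => /(congr1 (fun x => x - theta2 (C `&` U `*` V))).
have cancel (a b c : \bar R) : a \is a fin_num -> a + b - a = a + c - a -> c = b.
  by move=> fa; rewrite (addeC a b) (addeC a c) !addeK.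
exact: cancel.
Qed.

Lemma campbell_class_bigcup (F : (set (T * T))^nat) : (forall n, measurable (F n)) ->
  trivIset setT F -> (forall n, campbell_class (F n)) -> campbell_class (\bigcup_n F n).
Proof.
move=> mF tF cF; split; first exact: bigcup_measurable.
have tFR : trivIset setT (fun n => F n `&` U `*` V) by exact: trivIset_setIr.
have hE w : h (\bigcup_n F n) w = \sum_(n <oo) h (F n) w.
  by rewrite /h setI_bigcupl pair_count_bigcup// nneseriesZl// => n _; exact: pair_count_ge0.
have mhF n : measurable_fun setT (h (F n)) by have [_ []] := cF n.
split.
  apply: (eq_measurable_fun (fun w => \sum_(n <oo) h (F n) w)).
    by move=> w _; rewrite hE.
  exact: ge0_emeasurable_sum.
under eq_integral do rewrite hE.
rewrite integral_nneseries// setI_bigcupl measure_bigcup//; last first.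
  by move=> n _; exact: measurableI.
rewrite [RHS](eq_eseriesl (Q := xpredT)); last by move=> n; rewrite in_setT.
by apply: eq_eseriesr => n _; have [_ []] := cF n.
Qed.

Lemma campbell_rect C : measurable C -> campbell_class C.
Proof.
move=> mC.
apply: (@dynkin_induction _ _ [set A `*` B | A in measurable & B in measurable]
  campbell_class) => //.
- exact: measurable_prod_measurableType.
- move=> _ _ [A mA [B mB <-]] [A' mA' [B' mB' <-]].
  exists (A `&` A'); first exact: measurableI.
  exists (B `&` B'); first exact: measurableI.
  by apply/seteqP; split => -[x y] /=; tauto.
- exact: campbell_classT.
- by move=> _ [A mA [B mB <-]]; exact: campbell_class_rect.
- exact: campbell_classC.
- exact: campbell_class_bigcup.
- by rewrite -measurable_prod_measurableType.
Qed.

End rectangle.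

(** The rectangles U n * V n cover all pairs of distinct points; made disjoint, they
    split C into pieces to which campbell_rect applies. The number of pairs is
    replaced by a function f that agrees with it almost surely, since it can be
    handled only where all counts are finite. *)
Theorem campbell_pairs (U V : (set T)^nat) (C : set (T * T)) :
  (forall n, measurable (U n)) -> (forall n, measurable (V n)) ->
  (forall n, U n `&` V n = set0) ->
  (forall n, theta (U n) < +oo) -> (forall n, theta (V n) < +oo) ->
  (forall x y, x <> y -> exists n, U n x /\ V n y) ->
  measurable C -> (forall p, C p -> p.1 <> p.2) ->
  exists2 f : Omega -> \bar R, measurable_fun setT f /\ \int[P]_w f w = theta2 C &
    (forall w, 0 <= f w) /\ exists2 G, measurable G /\ P (~` G) = 0 &
      forall w, G w -> f w = pair_count (eta w) C.
Proof.
move=> mU mV UV Uoo Voo sep mC Cd.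
pose G := \bigcap_n (fin_event (R := R) eta (U n) `&` fin_event (R := R) eta (V n)).
have mG : measurable G.
  by apply: bigcap_measurableType => n _; apply: measurableI;
    exact: (measurable_fin_event heta).
have G0 : P (~` G) = 0.
  rewrite /G setC_bigcap; apply/negligibleP.
    by apply: bigcup_measurable => n _; apply: measurableC; apply: measurableI;
      exact: (measurable_fin_event heta).
  apply: negligible_bigcup => n; rewrite setCI; apply: negligibleU.
  - apply/negligibleP; first by apply: measurableC; exact: (measurable_fin_event heta).
    exact: (prob_fin_event heta (mU n) (Uoo n)).
  - apply/negligibleP; first by apply: measurableC; exact: (measurable_fin_event heta).
    exact: (prob_fin_event heta (mV n) (Voo n)).
have Gfin n w : G w -> finite_set (eta w `&` U n) /\ finite_set (eta w `&` V n).
  by move=> Gw; have [] := Gw n Logic.I; split; apply/(fin_event_set (R := R)).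
pose F := seqDU (fun n => U n `*` V n).
have mR n : measurable (U n `*` V n) by exact: measurableX.
have mF n : measurable (F n).
  by apply: measurableD => //; exact: bigsetU_measurable.
have FR n : F n `<=` U n `*` V n by exact: subset_seqDU.
have CE : C = \bigcup_n (C `&` F n).
  rewrite -setI_bigcupr -seqDU_bigcup_eq; apply/esym/setIidl => -[x y] Cxy.
  by have [n [Ux Vy]] := sep x y (Cd _ Cxy); exists n.
have tF : trivIset setT (fun n => C `&` F n).
  by apply: trivIset_setIl; exact: trivIset_seqDU.
have CFR n : (C `&` F n) `&` U n `*` V n = C `&` F n.
  by rewrite -setIA; congr (_ `&` _); exact/setIidl.
have camp n : measurable_fun setT (fun w => (\1_G w : R)%:E * pair_count (eta w) (C `&` F n)) /\
    \int[P]_w ((\1_G w)%:E * pair_count (eta w) (C `&` F n)) = theta2 (C `&` F n).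
  have := campbell_rect (mU n) (mV n) (UV n) (Uoo n) (Voo n) mG G0 (Gfin n)
    (measurableI _ _ mC (mF n)).
  by rewrite /campbell_class/= CFR => -[].
exists (fun w => (\1_G w)%:E * pair_count (eta w) C); last first.
  split; first by move=> w; rewrite mule_ge0// ?lee_fin ?indicE// pair_count_ge0.
  by exists G => // w Gw; rewrite indicE mem_set// mul1e.
have fE w : (\1_G w)%:E * pair_count (eta w) C =
    \sum_(n <oo) ((\1_G w)%:E * pair_count (eta w) (C `&` F n)).
  by rewrite {1}CE pair_count_bigcup// nneseriesZl// => n _; exact: pair_count_ge0.
have t0 n w : 0 <= (\1_G w)%:E * pair_count (eta w) (C `&` F n).
  by rewrite mule_ge0// ?lee_fin ?indicE// pair_count_ge0.
split.
  apply: (eq_measurable_fun (fun w =>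
    \sum_(n <oo) ((\1_G w)%:E * pair_count (eta w) (C `&` F n)))).
    by move=> w _; rewrite fE.
  by apply: ge0_emeasurable_sum => // n _; have [] := camp n.
under eq_integral do rewrite fE.
rewrite integral_nneseries//; last by move=> n; have [] := camp n.
rewrite [in RHS]CE measure_bigcup//; last by move=> n _; exact: measurableI.
rewrite [RHS](eq_eseriesl (Q := xpredT)); last by move=> n; rewrite in_setT.
by apply: eq_eseriesr => n _; have [] := camp n.
Qed.

End campbell.

(** * Integrals of functions that need not be measurable *)

Section lower_integral.
Context {d : measure_display} {T : measurableType d} {R : realType}.
Variable mu : {measure set T -> \bar R}.
Local Open Scope ereal_scope.

(** The integral of a nonnegative function is a supremum over the simple functions
    below it. *)
Lemma le_integral_nonmeasurable (f g : T -> \bar R) : (forall x, 0 <= f x) ->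
  (forall x, f x <= g x) -> \int[mu]_x f x <= \int[mu]_x g x.
Proof.
move=> f0 fg; have g0 x : 0 <= g x by exact: le_trans (f0 x) (fg x).
rewrite !ge0_integralTE//; apply: le_ereal_sup => _ [h hf <-]; exists h => // x.
exact: le_trans (hf x) (fg x).
Qed.

(** The function f lies between two measurable functions, equal to 0 and to +oo on N,
    that have the same integral as g. *)
Lemma integral_eq_off_null (f g : T -> \bar R) (N : set T) :
  measurable N -> mu N = 0 -> measurable_fun setT g ->
  (forall x, 0 <= f x) -> (forall x, 0 <= g x) -> (forall x, ~ N x -> f x = g x) ->
  \int[mu]_x f x = \int[mu]_x g x.
Proof.
move=> mN N0 mg f0 g0 fg.
have mif (c : \bar R) : measurable_fun setT (fun x => if x \in N then c else g x).
  apply: measurable_fun_ifT => //.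
  apply: (measurable_fun_bool true); rewrite setTI.
  by rewrite (_ : _ @^-1` _ = N)//; apply/seteqP; split => x /=; [move/set_mem|move/mem_set].
have ae c : (0 <= c) -> \int[mu]_x (if x \in N then c else g x) = \int[mu]_x g x.
  move=> c0; apply: ge0_ae_eq_integral => //.
  - by move=> x _; case: ifP.
  - exists N; split => // x /= xN; apply: contrapT => Nx; apply: xN => _.
    by rewrite memNset.
apply/eqP; rewrite eq_le; apply/andP; split.
- rewrite -(ae +oo) ?leey//; apply: le_integral_nonmeasurable => // x.
  by case: ifPn => [_|/negP xN]; [exact: leey|rewrite fg// => /mem_set].
- rewrite -(ae 0)//; apply: le_integral_nonmeasurable => x; first by case: ifP.
  by case: ifPn => [_|/negP xN]; [exact: f0|rewrite fg// => /mem_set].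
Qed.

End lower_integral.

(** * The intensity measure *)

Section intensity.
Context {R : realType} {d k : nat} {kd : (2 * k < d)%N}.
Variables (t : R) (Q : probability (grassmannian R kd) R).
Variable theta : {measure set (flat R kd) -> \bar R}.
Hypothesis htheta : is_flat_intensity t Q theta.
Local Notation leb n := (lebesgue_rV R n).

Definition flats_near0 (r : R) : set (flat R kd) := [set E | enorm (foot E) <= r].

Lemma measurable_flats_near0 r : measurable (flats_near0 r).
Proof. by apply: measurable_le_cst; apply: measurable_enorm; exact: measurable_foot. Qed.

Lemma intensity_indic (A : set (flat R kd)) : measurable A ->
  theta A = (t%:E * \int[Q]_L \int[lebesgue_on (orthocomp L)]_x
    (\1_A (translate L x))%:E)%E.
Proof.
move=> mA.
have m1A : measurable_fun setT (\1_A : flat R kd -> R) by exact: measurable_indic.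
rewrite -(htheta m1A); last by move=> E; rewrite indicE.
by rewrite integral_indic// setIT.
Qed.

Lemma onb_orthocomp_rej n (W : {vspace 'rV[R]_n}) (y : 'rV[R]_(\dim (orthocomp W))) :
  y *m onb (orthocomp W) *m rej W = y *m onb (orthocomp W).
Proof.
by rewrite /rej -proj_orthocomp /oproj -!mulmxA (mulmxA (onb _)) onbK mul1mx.
Qed.

Lemma enorm_onb n (W : {vspace 'rV[R]_n}) (y : 'rV[R]_(\dim W)) : enorm (y *m onb W) = enorm y.
Proof. by rewrite /enorm /dotprod trmx_mul mulmxA -(mulmxA y) onbK mulmx1. Qed.

Lemma flats_near0_translate (L : grassmannian R kd) (y : 'rV[R]_(\dim (orthocomp L))) r :
  flats_near0 r (translate L (y *m onb (orthocomp L))) <-> enorm y <= r.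
Proof. by rewrite /flats_near0/= foot_translate onb_orthocomp_rej enorm_onb. Qed.

(** The value is the same for all L, because every L^perp has dimension d - k. *)
Lemma lebesgue_on_near0 (L : grassmannian R kd) r :
  (\int[lebesgue_on (orthocomp L)]_x (\1_(flats_near0 r) (translate L x))%:E =
   leb (d - k) [set y | enorm y <= r]%R)%E.
Proof.
have -> : (d - k)%N = \dim (orthocomp L).
  by have := dim_orthocomp L; rewrite dim_grassmannian => /(congr1 (subn^~ k)); rewrite addnK.
rewrite integral_lebesgue_on.
- have mE := @measurable_eball R (\dim (orthocomp L)) r.
  rewrite -[in RHS](setIT [set y | _]) -integral_indic//; apply: eq_integral => y _.
  rewrite !indicE; congr (_%:R%:E); congr nat_of_bool.
  by apply/idP/idP => /set_mem/flats_near0_translate ?; exact: mem_set.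
- apply/measurable_EFinP; apply: measurableT_comp (measurable_translate L).
  by apply: measurable_indic; exact: measurable_flats_near0.
- by move=> x; rewrite lee_fin indicE.
Qed.

Lemma intensity_near0_fin r : (theta (flats_near0 r) < +oo)%E.
Proof.
rewrite intensity_indic; last exact: measurable_flats_near0.
under eq_integral do rewrite lebesgue_on_near0.
have cfin : leb (d - k) [set y | enorm y <= r] \is a fin_num.
  by rewrite ge0_fin_numE//; exact: lebesgue_eball_fin.
rewrite integral_cst// [X in (_ * (_ * X))%E](_ : _ = 1%E); last exact: probability_setT.
by rewrite mule1 -(fineK cfin) -EFinM ltry.
Qed.

Lemma flats_near0_bigcup : \bigcup_n flats_near0 n%:R = setT.
Proof.
apply/seteqP; split => // E _; exists (Num.truncn (enorm (foot E))).+1 => //.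
by rewrite /flats_near0/= ltW// truncnS_gt.
Qed.

Lemma intensity_sigma_finite : sigma_finite setT theta.
Proof.
exists (fun n => flats_near0 n%:R); first by rewrite flats_near0_bigcup.
by move=> n; split; [exact: measurable_flats_near0|exact: intensity_near0_fin].
Qed.

End intensity.

Section bundle_sigma_finite.
Context {d : measure_display} {T : measurableType d} {R : realType}.
Variables (mu : {measure set T -> \bar R}) (mu_sf : sigma_finite setT mu).

(** Product measures expect sigma-finiteness to be part of the type of the measure;
    for an intensity measure it is a consequence of is_flat_intensity. *)
Definition with_sigma_finite of sigma_finite setT mu : set T -> \bar R := mu.

HB.instance Definition _ := isMeasure.Build _ _ _ (with_sigma_finite mu_sf)
  (measure0 mu) (measure_ge0 mu) (@measure_semi_sigma_additive _ _ _ mu).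

HB.instance Definition _ := @Measure_isSigmaFinite.Build _ _ _
  (with_sigma_finite mu_sf) mu_sf.

End bundle_sigma_finite.

(** The intensity is expanded for the first flat, then Tonelli's theorem exchanges
    Lebesgue measure on M^perp with the intensity measure of the second flat, and
    only then that one is expanded. In this order Tonelli's theorem involves two
    fixed measures and not the family of Lebesgue measures on all L^perp. *)
Section pair_intensity.
Context {R : realType} {d k : nat} {kd : (2 * k < d)%N}.
Variables (t : R) (Q : probability (grassmannian R kd) R).
Variable theta : {sigma_finite_measure set (flat R kd) -> \bar R}.
Hypothesis htheta : is_flat_intensity t Q theta.
Local Notation leb n := (lebesgue_rV R n).
Local Open Scope ereal_scope.

Lemma intensity_integral (f : flat R kd -> \bar R) : measurable_fun setT f ->
  (forall E, 0 <= f E) -> (forall E, f E < +oo) ->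
  \int[theta]_E f E =
  t%:E * \int[Q]_L \int[lebesgue_on (orthocomp L)]_x f (translate L x).
Proof.
move=> mf f0 foo.
have fE E : f E = (fine (f E))%:E by rewrite fineK// ge0_fin_numE.
under eq_integral do rewrite fE.
rewrite (htheta (measurableT_comp (fine_measurable measurableT) mf)); last first.
  by move=> E; rewrite fine_ge0.
by congr (_ * _); apply: eq_integral => L _; apply: eq_integral => x _; rewrite -fE.
Qed.

Lemma pair_intensity (A : set (flat R kd * flat R kd)) r : measurable A ->
  A `<=` flats_near0 r `*` flats_near0 r ->
  (theta \x theta) A = t%:E * \int[Q]_M (t%:E * \int[Q]_L
    \int[lebesgue_on (orthocomp L)]_y \int[lebesgue_on (orthocomp M)]_x
      (\1_A (translate M x, translate L y))%:E).
Proof.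
move=> mA Ar; pose B : set (flat R kd) := flats_near0 r.
have mB : measurable B by exact: measurable_flats_near0.
have Boo : theta B < +oo by exact: (intensity_near0_fin htheta r).
have m1A : measurable_fun setT (\1_A : flat R kd * flat R kd -> R) by exact: measurable_indic.
have A0 p : 0 <= (\1_A p : R)%:E by rewrite lee_fin indicE.
have xsB E : xsection A E `<=` B by move=> F /set_mem/Ar[].
have mxs E : measurable (xsection A E) by exact: measurable_xsection.
have xsE E : theta (xsection A E) = \int[theta]_F (\1_A (E, F))%:E.
  rewrite -[X in theta X]setIT -integral_indic//; apply: eq_integral => F _.
  by rewrite !indicE mem_xsection.
transitivity (\int[theta]_E theta (xsection A E)); first by [].
rewrite intensity_integral//; last 2 first.
- exact: (measurable_fun_xsection theta mA).
- by move=> E; exact: le_lt_trans (le_measureS theta (mxs E) mB (xsB E)) Boo.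
congr (_ * _); apply: eq_integral => M _.
pose b := \dim (orthocomp M).
pose f (p : 'rV[R]_b * flat R kd) : \bar R :=
  (\1_A (translate M (p.1 *m onb (orthocomp M)), p.2))%:E.
have f0 p : 0 <= f p by exact: A0.
have mtr : measurable_fun setT (fun v : 'rV[R]_b => translate M (v *m onb (orthocomp M))).
  exact: measurableT_comp (measurable_translate M) (measurable_mulmxr _).
have mf : measurable_fun setT f.
  apply/measurable_EFinP; apply: (measurableT_comp m1A).
  by apply: measurable_fun_pair => //; exact: measurableT_comp mtr measurable_fst.
have mxsE : measurable_fun setT (fun x : 'rV[R]_d => theta (xsection A (translate M x))).
  exact: measurableT_comp (measurable_fun_xsection theta mA) (measurable_translate M).
rewrite integral_lebesgue_on//.
transitivity (\int[leb b]_v \int[theta]_F f (v, F)).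
  by apply: eq_integral => v _; rewrite xsE.
rewrite fubini_tonelli//.
have onE (F : flat R kd) : \int[lebesgue_on (orthocomp M)]_x (\1_A (translate M x, F))%:E =
    \int[leb b]_v f (v, F).
  rewrite integral_lebesgue_on//.
  apply/measurable_EFinP; apply: (measurableT_comp m1A).
  by apply: measurable_fun_pair => //; exact: measurable_translate.
pose g F := \int[leb b]_v f (v, F).
have mg : measurable_fun setT g by apply: measurable_fun_fubini_tonelli_G.
have g0 F : 0 <= g F by exact: integral_ge0.
have goo F : g F < +oo.
  apply: le_lt_trans (@lebesgue_eball_fin R b r).
  rewrite -[X in leb b X]setIT -integral_indic//; last exact: measurable_eball.
  apply: ge0_le_integral => //.
  - exact: measurableT_comp mf (pair2_measurable F).
  - by apply/measurable_EFinP; apply: measurable_indic; exact: measurable_eball.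
  - move=> v _; rewrite lee_fin !indicE ler_nat.
    case: (boolP (_ \in A)) => // /set_mem/Ar[/= vB _].
    by rewrite mem_set//; apply/flats_near0_translate.
apply: etrans (intensity_integral mg g0 goo) _.
congr (_ * _); apply: eq_integral => L _; apply: eq_integral => y _.
by rewrite onE.
Qed.

End pair_intensity.

Section pairs_of_directions.
Context {R : realType} {d k : nat} {kd : (2 * k < d)%N}.
Implicit Types (M L : grassmannian R kd).

Lemma measurable_det_gap : measurable_fun setT
  (fun q : grassmannian R kd * grassmannian R kd => \det (gap q.1 q.2)).
Proof.
apply: measurable_det; apply: measurable_addmx.
- exact: measurableT_comp measurable_rej measurable_fst.
- exact: measurableT_comp measurable_rej measurable_snd.
Qed.

Lemma measurable_subspace_det : measurable_fun setT
  (fun q : grassmannian R kd * grassmannian R kd => subspace_det q.1 q.2).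
Proof.
under eq_fun do rewrite subspace_detE !dim_grassmannian.
apply/measurable_EFinP; apply: measurable_sqrt; apply: measurable_funM => //.
exact: measurable_det_gap.
Qed.

Lemma gp_pairs_translate M L x y :
  gp_pairs (translate M x, translate L y) <-> general_position M L.
Proof.
rewrite /gp_pairs/= /pair_gap/= !flat_rej_translate -/(gap M L).
by split => [|/gap_unit]; rewrite ?unitmxE ?unitfE// => ?; apply/gap_unit; rewrite unitmxE unitfE.
Qed.

Lemma subspace_det_degenerate M L : ~ general_position M L -> subspace_det M L = 0%E.
Proof. by move=> ML; rewrite /subspace_det; case: dim_sum_gp. Qed.

Lemma dotprod_add_le (n : nat) (a b : 'rV[R]_n) :
  dotprod (a + b) (a + b) <= 2 * dotprod a a + 2 * dotprod b b.
Proof.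
have := dotprod_ge0 (a - b).
rewrite !(dotprodDl, dotprodDr, dotprodNl, dotprodNr) (dotprodC b a); lra.
Qed.

(** The closest points are bounded because the midpoint lies in K and the difference
    vector has length at most delta. *)
Lemma near_pairs_bounded (K : set 'rV[R]_d) (delta : R) : compact K -> 0 <= delta ->
  exists r, near_pairs K delta `<=` flats_near0 (kd := kd) r `*` flats_near0 r.
Proof.
move=> /compact_sqnorm_bounded[C C0 KC] delta0.
exists (Num.sqrt (2 * C + 2 * delta ^+ 2)) => p [[p0 dp] Kp].
have dpp : dotprod (2^-1 *: pair_diff p) (2^-1 *: pair_diff p) <= delta ^+ 2.
  have := dp; rewrite /= enorm_le//; apply: le_trans.
  rewrite linearZ/= dotprodC linearZ/= /GRing.scale/= mulrA.
  by rewrite ler_piMl ?dotprod_ge0//; lra.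
have bnd (E : flat R kd) z : flat_points E z -> dotprod z z <= 2 * C + 2 * delta ^+ 2 ->
    flats_near0 (Num.sqrt (2 * C + 2 * delta ^+ 2)) E.
  move=> /mem_flat zE zC; rewrite /flats_near0/= -zE.
  apply: ler_wsqrtr; apply: le_trans zC.
  exact: dotprod_rej_le.
split; [apply: bnd (closest1_mem p) _|apply: bnd (closest2_mem p0) _];
  apply: le_trans (dotprod_add_le _ _) _; rewrite ?dotprodNl ?dotprodNr ?opprK.
  by apply: lerD; rewrite ler_pM2l//; exact: KC.
by apply: lerD; rewrite ler_pM2l//; exact: KC.
Qed.

End pairs_of_directions.

Section mean_number_of_pairs.
Context {R : realType} {d k : nat} {kd : (2 * k < d)%N}.
Variables (t : R) (Q : probability (grassmannian R kd) R).
Variable theta : {sigma_finite_measure set (flat R kd) -> \bar R}.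
Hypothesis t0 : 0 < t.
Hypothesis htheta : is_flat_intensity t Q theta.
Hypothesis hQ : {ae (Q \x Q)%E, forall LM : grassmannian R kd * grassmannian R kd,
             general_position LM.1 LM.2}.
Local Open Scope ereal_scope.

Lemma intensity_near_pairs (K : set 'rV[R]_d) (delta : R) : compact K -> (0 <= delta)%R ->
  (theta \x theta) (near_pairs K delta) =
  t%:E * (t%:E * (unit_ball_volume (d - 2 * k) * (delta ^+ (d - 2 * k))%:E *
    lebesgue_rV R d K * \int[Q]_M \int[Q]_L subspace_det M L)).
Proof.
move=> cK delta0; have [r Ar] := @near_pairs_bounded R d k kd K delta cK delta0.
rewrite (pair_intensity htheta (measurable_near_pairs delta cK) Ar); congr (_ * _).
set c := unit_ball_volume _ * _ * _.
have c0 : 0 <= c by rewrite /c /unit_ball_volume !mule_ge0// lee_fin exprn_ge0.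
have mS (M : grassmannian R kd) :
    measurable_fun setT (fun L : grassmannian R kd => subspace_det M L).
  exact: (measurableT_comp (@measurable_subspace_det R d k kd) (pair1_measurable M)).
have S0 (M L : grassmannian R kd) : 0 <= subspace_det M L by exact: subspace_det_ge0.
have mSS : measurable_fun setT (fun M : grassmannian R kd => \int[Q]_L subspace_det M L).
  apply: (measurable_fun_fubini_tonelli_F
    (fun q : grassmannian R kd * grassmannian R kd => subspace_det q.1 q.2)) => //.
  exact: measurable_subspace_det.
have SS0 (M : grassmannian R kd) : 0 <= \int[Q]_L subspace_det M L by exact: integral_ge0.
transitivity (\int[Q]_M ((t%:E * c) * \int[Q]_L subspace_det M L)).
  apply: eq_integral => M _; rewrite -muleA; congr (_ * _).
  rewrite -ge0_integralZl//; apply: eq_integral => L _.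
  have [ML|nML] := pselect (general_position M L); first exact: kinematic.
  rewrite subspace_det_degenerate// mule0; apply: integral0_eq => y _.
  apply: integral0_eq => x _; rewrite indicE memNset// => -[[/gp_pairs_translate]].
  by [].
rewrite ge0_integralZl//; last by rewrite mule_ge0// lee_fin ltW.
exact/esym/muleA.
Qed.

(** The set of pairs of directions that are not in general position is null, and so
    is +oo times its indicator function, which bounds the inner integrals. *)
Lemma intensity_degenerate_pairs (A : set (flat R kd * flat R kd)) : measurable A ->
  A `<=` ~` gp_pairs -> (theta \x theta) A = 0.
Proof.
move=> mA Agp.
pose B n : set (flat R kd * flat R kd) := flats_near0 n%:R `*` flats_near0 n%:R.
have mB n : measurable (B n) by apply: measurableX; exact: measurable_flats_near0.
have -> : A = \bigcup_n (A `&` B n).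
  apply/esym; rewrite -setI_bigcupr; apply/setIidl => -[E F] _.
  pose n := (Num.truncn (Num.max (enorm (foot E)) (enorm (foot F)))).+1.
  have nE : (Num.max (enorm (foot E)) (enorm (foot F)) <= n%:R)%R by rewrite ltW// truncnS_gt.
  by exists n => //; split; apply: le_trans nE; rewrite le_max lexx ?orbT.
have mAB n : measurable (A `&` B n) by exact: measurableI.
apply/negligibleP; first exact: bigcup_measurable.
apply: negligible_bigcup => n; apply/negligibleP => //.
apply: etrans (pair_intensity htheta (mAB n) (@subIsetr _ _ _)) _.
pose N := [set q : grassmannian R kd * grassmannian R kd | \det (gap q.1 q.2) = 0%R].
have mN : measurable N.
  exact: (measurable_preimage (@measurable_det_gap R d k kd) (measurable_set1 0%R)).
have QN : (Q \x Q) N = 0.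
  apply/negligibleP => //; apply: negligibleS hQ => q /= qN qgp.
  by move/gap_unit : qgp; rewrite unitmxE qN unitr0.
have t_ge0 : 0 <= t%:E by rewrite lee_fin ltW.
pose I (M L : grassmannian R kd) := \int[lebesgue_on (orthocomp L)]_y
  \int[lebesgue_on (orthocomp M)]_x (\1_(A `&` B n) (translate M x, translate L y) : R)%:E.
have I0 (M L : grassmannian R kd) : 0 <= I M L.
  by apply: integral_ge0 => y _; apply: integral_ge0 => x _; rewrite lee_fin indicE.
have tI0 (M : grassmannian R kd) : 0 <= t%:E * \int[Q]_L I M L.
  by apply: mule_ge0 => //; exact: integral_ge0.
apply/eqP; rewrite mule_eq0; apply/orP; right; rewrite eq_le.
apply/andP; split; last by apply: integral_ge0 => M _; exact: tI0.
have mxN (M : grassmannian R kd) : measurable (xsection N M) by exact: measurable_xsection.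
apply: (@le_trans _ _ (\int[Q]_M (+oo * Q (xsection N M)))); last first.
  rewrite ge0_integralZl//; last exact: (measurable_fun_xsection Q mN).
  by rewrite [X in _ * X](_ : _ = (Q \x Q) N)// QN mule0.
apply: le_integral_nonmeasurable => M; first exact: tI0.
have -> : +oo * Q (xsection N M) = t%:E * (+oo * Q (xsection N M)).
  by rewrite muleA gt0_muley// lte_fin.
rewrite lee_pmul2l// ?lte_fin//.
have -> : +oo * Q (xsection N M) = \int[Q]_L (+oo * (\1_(xsection N M) L : R)%:E).
  rewrite ge0_integralZl//.
  - by rewrite integral_indic// setIT.
  - by apply/measurable_EFinP; exact: measurable_indic.
apply: le_integral_nonmeasurable => L; first exact: I0.
have [ML|nML] := pselect (general_position M L).
  rewrite integral0_eq ?mule_ge0 ?lee_fin ?indicE// => y _.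
  apply: integral0_eq => x _; rewrite indicE memNset// => -[/Agp].
  by rewrite /setC/= -/(gp_pairs _) gp_pairs_translate.
rewrite indicE mem_set ?mule1 ?leey//; apply: mem_set => /=.
by apply/eqP; apply: contra_notT nML => ?; apply/gap_unit; rewrite unitmxE unitfE.
Qed.

End mean_number_of_pairs.

(** * The mean of the proximity functional *)

(** Flats are told apart by comparing one coordinate with a rational number; the
    boolean selects a side and the natural number bounds the distance to the origin,
    so that the intensity is finite. *)
Definition half_index (d : nat) : Type := (('I_d * 'I_d + 'I_d) * rat * bool * nat)%type.

Section separation.
Context {R : realType} {d k : nat} {kd : (2 * k < d)%N}.

Definition flat_coord (a : ('I_d * 'I_d) + 'I_d) (E : flat R kd) : R :=
  match a with inl ij => flat_rej E ij.1 ij.2 | inr i => foot E 0 i end.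

Lemma measurable_flat_coord a : measurable_fun setT (flat_coord a).
Proof.
case: a => [[i j]|i]; first exact: measurable_mxE measurable_flat_rej.
exact: measurable_mxE measurable_foot.
Qed.

Lemma flat_coord_inj (E F : flat R kd) : (forall a, flat_coord a E = flat_coord a F) -> E = F.
Proof.
move=> EF; apply: flat_rej_foot_inj; apply/matrixP => i j.
  exact: (EF (inl (i, j))).
by rewrite ord1; exact: (EF (inr j)).
Qed.

Definition half_flats (c : half_index d) : set (flat R kd) :=
  let: (a, q, b, n) := c in flats_near0 n%:R `&`
    (if b then flat_coord a @^-1` `]-oo, ratr q[ else flat_coord a @^-1` `]ratr q, +oo[).

Definition flip_half (c : half_index d) :=
  let: (a, q, b, n) := c in (a, q, ~~ b, n).

Lemma measurable_half_flats c : measurable (half_flats c).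
Proof.
case: c => [[[a q] b] n]; apply: measurableI; first exact: measurable_flats_near0.
by case: b; apply: measurable_preimage => //; exact: measurable_flat_coord.
Qed.

Lemma half_flats_disjoint c : half_flats c `&` half_flats (flip_half c) = set0.
Proof.
case: c => [[[a q] b] n]; apply/seteqP; split => // E [[_ +] [_]].
by case: b; rewrite /= !in_itv/= ?andbT => E1 E2; have := lt_trans E1 E2; rewrite ltxx.
Qed.

Lemma half_flats_separate (E F : flat R kd) : E <> F ->
  exists c, half_flats c E /\ half_flats (flip_half c) F.
Proof.
move=> EF; have [a aEF] : exists a, flat_coord a E != flat_coord a F.
  apply: contrapT => H; apply: EF; apply: flat_coord_inj => a.
  by apply: contrapT => /eqP ?; apply: H; exists a.
pose n := (Num.truncn (Num.max (enorm (foot E)) (enorm (foot F)))).+1.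
have nE : Num.max (enorm (foot E)) (enorm (foot F)) <= n%:R by rewrite ltW// truncnS_gt.
have En : flats_near0 n%:R E by apply: le_trans nE; rewrite le_max lexx.
have Fn : flats_near0 n%:R F by apply: le_trans nE; rewrite le_max lexx orbT.
move: aEF; rewrite neq_lt => /orP[] /rat_in_itvoo[q]; rewrite in_itv/= => /andP[q1 q2].
- by exists (a, q, true, n); split; split => //=; rewrite in_itv/= ?andbT.
- by exists (a, q, false, n); split; split => //=; rewrite in_itv/= ?andbT.
Qed.

Lemma separating_flat_sequences : exists U V : (set (flat R kd))^nat,
  [/\ forall n, measurable (U n), forall n, measurable (V n) &
    (forall n, U n `&` V n = set0) /\
    ((forall n, (exists r, U n `<=` flats_near0 r) /\ (exists r, V n `<=` flats_near0 r)) /\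
    (forall E F : flat R kd, E <> F -> exists n, U n E /\ V n F))].
Proof.
pose H (f : half_index d -> half_index d) n : set (flat R kd) :=
  if (choice.unpickle n : option (('I_d * 'I_d + 'I_d) * rat * bool * nat)) is Some c
  then half_flats (f c) else set0.
have near_half c : exists r, half_flats c `<=` flats_near0 r.
  by case: c => [[[a q] b] n]; exists n%:R; exact: subIsetl.
have near_H f n : exists r, H f n `<=` flats_near0 r.
  rewrite /H; case: choice.unpickle => [c|]; first exact: near_half.
  by exists 0; exact: sub0set.
exists (H id), (H flip_half); split.
- by move=> n; rewrite /H; case: choice.unpickle => // c; exact: measurable_half_flats.
- by move=> n; rewrite /H; case: choice.unpickle => // c; exact: measurable_half_flats.
- split.
    move=> n; rewrite /H; case: choice.unpickle => [c|]; last by rewrite set0I.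
    exact: half_flats_disjoint.
  split; first by move=> n; split; exact: near_H.
  move=> E F /half_flats_separate[c [cE cF]];
  exists (choice.pickle (c : ('I_d * 'I_d + 'I_d) * rat * bool * nat)).
  by rewrite /H choice.pickleK.
Qed.

(** The direction of a flat has positive dimension and meets itself in more than 0. *)
Lemma gp_pairs_neq (p : flat R kd * flat R kd) : (1 <= k)%N -> gp_pairs p -> p.1 <> p.2.
Proof.
case: p => E F k1 /= p0 EF; subst F.
have : gap (flat_dir E) (flat_dir E) \in unitmx by rewrite unitmxE unitfE.
move=> /gap_unit; rewrite /general_position capvv => E0.
by have := dim_grassmannian (flat_dir E); rewrite E0 dimv0 => k0; rewrite -k0 in k1.
Qed.

End separation.

Theorem theorem2p1 (R : realType) (d k : nat)
    (hk : (1 <= k)%N) (hkd : (2 * k < d)%N)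
    (Q : probability (grassmannian R hkd) R)
    (hQ : {ae (Q \x Q)%E, forall LM : grassmannian R hkd * grassmannian R hkd,
             general_position LM.1 LM.2})
    (t : R) (ht : 0 < t)
    (theta : {measure set (flat R hkd) -> \bar R})
    (htheta : is_flat_intensity t Q theta)
    (disp : measure_display) (Omega : measurableType disp)
    (P : probability Omega R)
    (eta : Omega -> set (flat R hkd)) (heta : poisson_process P theta eta)
    (delta : R) (hdelta : 0 <= delta)
    (K : set 'rV[R]_d) (hK : convex_body K) :
  (\int[P]_w proximity (eta w) K delta =
   (t ^+ 2 / 2)%:E * unit_ball_volume (d - 2 * k) * (delta ^+ (d - 2 * k))%:E *
   lebesgue_rV R d K *
   \int[Q]_M \int[Q]_L subspace_det M L)%E.
Proof.
have [cK _ _] := hK.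
pose th : {sigma_finite_measure set (flat R hkd) -> \bar R} :=
  with_sigma_finite (intensity_sigma_finite htheta).
have hth : is_flat_intensity t Q th by exact: htheta.
have hp : poisson_process P th eta by case: heta => *; split.
have [U [V [mU mV [UV [UVr sep]]]]] := @separating_flat_sequences R d k hkd.
have near_oo (A : set (flat R hkd)) : measurable A ->
    (exists r, A `<=` flats_near0 r) -> (th A < +oo)%E.
  move=> mA [r Ar]; apply: le_lt_trans (intensity_near0_fin hth r).
  by apply: le_measureS => //; exact: measurable_flats_near0.
have Uoo n : (th (U n) < +oo)%E by apply: near_oo => //; exact: (UVr n).1.
have Voo n : (th (V n) < +oo)%E by apply: near_oo => //; exact: (UVr n).2.
pose C := near_pairs (kd := hkd) K delta.
have mC : measurable C by exact: measurable_near_pairs.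
have Cneq p : C p -> p.1 <> p.2 by move=> [[+ _] _]; exact: gp_pairs_neq.
pose D := \bigcup_n (U n `*` V n) `&` ~` gp_pairs.
have mD : measurable D.
  apply: measurableI; last by apply: measurableC; exact: measurable_gp_pairs.
  by apply: bigcup_measurable => n _; exact: measurableX.
have [f [mf Ef] [f0 [G [mG G0] fE]]] := campbell_pairs hp mU mV UV Uoo Voo sep mC Cneq.
have Dneq p : D p -> p.1 <> p.2.
  case: p => x y [[n _ [/= Ux Vy]] _] xy; rewrite -xy in Vy.
  by have : (U n `&` V n) x by []; rewrite UV.
have [g [mg Eg] [g0 [G' [mG' G'0] gE]]] := campbell_pairs hp mU mV UV Uoo Voo sep mD Dneq.
have {}Eg : (\int[P]_w `|g w| = 0)%E.
  under eq_integral do rewrite gee0_abs//.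
  by apply: etrans Eg _; apply: (intensity_degenerate_pairs ht hth hQ mD) => p [].
have [Z [mZ Z0 gZ]] : P.-negligible [set w | g w != 0%E].
  have /ae_eq_integral_abs : measurable_fun setT g by [].
  move=> /(_ P measurableT) [/(_ Eg) gae _].
  by apply: negligibleS gae => w /= + gw; rewrite gw// eqxx.
pose N := Z `|` (~` G `|` ~` G').
have mN : measurable N by apply: measurableU => //; apply: measurableU; exact: measurableC.
have N0 : P N = 0%E.
  have mGC := measurableC mG; have mGC' := measurableC mG'.
  apply/negligibleP => //; apply: negligibleU; first exact/negligibleP.
  by apply: negligibleU; exact/negligibleP.
have prox w : ~ N w -> proximity (eta w) K delta = ((2^-1)%:E * f w)%E.
  move=> Nw; have Gw : G w by apply: contrapT => ?; apply: Nw; right; left.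
  have G'w : G' w by apply: contrapT => ?; apply: Nw; right; right.
  have gw : g w = 0%E by apply: contrapT => /eqP gw; apply: Nw; left; exact: gZ.
  have gp p : distinct (eta w) p -> gp_pairs p.
    move=> pw; apply: contrapT => ngp.
    have Dp : D p.
      split => //; case: pw => _ _ /sep[n [Ux Vy]]; by exists n.
    suff : (1 <= g w)%E by rewrite gw lee_fin ler10.
    rewrite gE//; apply: esum_ge; exists [set p]; last by rewrite fsbig_set1.
    by split => [|q ->]; [exact: finite_set1|split].
  rewrite fE// /proximity /pair_count; congr (_ * _)%E.
  rewrite esum_mkcondr; apply: eq_esum => p pw.
  have CE := near_pairsE K delta (gp p pw).
  rewrite indicE; case: ifPn => [/set_mem/CE pC|/negP pC].
    by rewrite mem_set.
  by rewrite memNset// => /CE ?; apply: pC; exact: mem_set.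
transitivity (\int[P]_w ((2^-1)%:E * f w))%E.
  apply: (integral_eq_off_null mN N0) => //.
  - exact: measurable_funeM.
  - move=> w; apply: mule_ge0; first by rewrite lee_fin.
    by apply: esum_ge0 => p _; rewrite lee_fin indicE.
  - by move=> w; apply: mule_ge0.
rewrite ge0_integralZl_EFin// Ef.
apply: (etrans (congr1 (fun x => (2^-1)%:E * x)%E (intensity_near_pairs ht hth cK hdelta))).
rewrite !muleA -!EFinM; congr (_%:E * _ * _ * _ * _)%E.
by field.
Qed.
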